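(* Let $d\ge3$ and let $V_1,\dots,V_d$ be real vector spaces of real dimensions $n_1\le\cdots\le n_d$ with $n_1\ge2$. For any $k\ge2$, $$\pi_k\bigl(\{A\in V_1\otimes\cdots\otimes V_d:\operatorname{rank}(A)=1\}\bigr)\cong\prod_{j=1}^d\pi_k(\mathbb{S}^{n_j-1}).$$ In particular, if $2\le k\le n_1-1$, then $$\pi_k\bigl(\{A\in V_1\otimes\cdots\otimes V_d:\operatorname{rank}(A)=1\}\bigr)=0.$$
   Context: All sets carry the Euclidean topology. $\operatorname{rank}(A)=1$ means that $A=v_1\otimes\cdots\otimes v_d$ for some nonzero $v_j\in V_j$. $\mathbb{S}^n$ is the $n$-sphere.
   Formalization: The vanishing clause is proved for 2 ≤ k ≤ n_1−2 instead of 2 ≤ k ≤ n_1−1; at k = n_1−1 ≥ 2 it is false, since the product then contains the factor π_k(S^k) = ℤ (e.g. n_1 = 3, k = 2). *)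

(* Defs.v *)
From HB Require Import structures.
From mathcomp Require Import all_boot all_order all_algebra.
From mathcomp Require Import generic_quotient.
From mathcomp Require Import all_classical all_reals topology normedtype.
From mathcomp Require Import ring lra.
Set Implicit Arguments.
Unset Strict Implicit.
Unset Printing Implicit Defensive.
Import Order.TTheory GRing.Theory Num.Theory.
Import numFieldNormedType.Exports.
Local Open Scope classical_set_scope.
Local Open Scope ring_scope.
Local Open Scope quotient_scope.

Section continuity_facts.
Context {R : realType}.

Lemma within_comp (Y Z X : topologicalType) (B : set Y) (A : set Z)
    (phi : Y -> Z) (f : Z -> X) :
  {within B, continuous phi} -> (forall y, B y -> A (phi y)) ->
  {within A, continuous f} -> {within B, continuous (fun y => f (phi y))}.
Proof.
move=> /subspace_continuousP cphi BA /subspace_continuousP cf.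
apply/subspace_continuousP => y By.
move=> U /(cf _ (BA _ By)) fU; have := cphi _ By _ fU.
rewrite !nbhs_simpl /= /within /=.
by apply: filterS => z /= zU Bz; apply: zU => //; exact: BA.
Qed.

Lemma within_glue (Z X : topologicalType) (D : set Z) (u : Z -> R) (c : R)
    (F G : Z -> X) : closed D -> continuous u ->
  {within D `&` [set z | u z <= c], continuous F} ->
  {within D `&` [set z | c <= u z], continuous G} ->
  (forall z, D z -> u z = c -> F z = G z) ->
  {within D, continuous (fun z => if u z <= c then F z else G z)}.
Proof.
move=> cD cu cF cG FG.
have -> : D = (D `&` [set z | u z <= c]) `|` (D `&` [set z | c <= u z]).
  rewrite -setIUr; apply/seteqP; split=> [z Dz|z []//]; split=> //=.
  by case: (leP (u z) c) => [|/ltW]; [left|right].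
apply: withinU_continuous.
- by apply: closedI => //; apply: (closed_comp _ (@closed_le _ c)) => z _; exact: cu.
- by apply: closedI => //; apply: (closed_comp _ (@closed_ge _ c)) => z _; exact: cu.
- apply: subspace_eq_continuous cF => z; rewrite inE => -[_ /= uzc].
  by rewrite /from_subspace uzc.
- apply: subspace_eq_continuous cG => z; rewrite inE => -[Dz /= cuz].
  rewrite /from_subspace.
  by case: ifPn => // uzc; rewrite -FG//; apply/eqP; rewrite eq_le uzc.
Qed.

Lemma row_continuous (Z : topologicalType) k (g : Z -> 'rV[R]_k) :
  (forall i, continuous (fun z => g z 0 i)) -> continuous g.
Proof.
move=> cg z U [/= P Pnb PU]; apply: filterS; first exact: PU.
have : \forall w \near z, forall i : 'I_k, P 0 i (g w 0 i).
  by apply: filter_forall => i; apply: cg; exact: Pnb.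
apply: filterS => w Pw i j; rewrite (ord1 i); exact: Pw.
Qed.

Lemma fst_continuous (Y Z : topologicalType) : continuous (@fst Y Z).
Proof. by move=> z; exact: cvg_fst. Qed.

Lemma snd_continuous (Y Z : topologicalType) : continuous (@snd Y Z).
Proof. by move=> z; exact: cvg_snd. Qed.

Lemma pair_continuous (W Y Z : topologicalType) (f : W -> Y) (g : W -> Z) :
  continuous f -> continuous g -> continuous (fun w => (f w, g w)).
Proof. by move=> cf cg w; apply: cvg_pair; [exact: cf|exact: cg]. Qed.

Lemma comp_continuous (W Y Z : topologicalType) (f : W -> Y) (g : Y -> Z) :
  continuous f -> continuous g -> continuous (fun w => g (f w)).
Proof. by move=> cf cg w; apply: continuous_comp; [exact: cf|exact: cg]. Qed.

Lemma fun_addr_continuous (W : topologicalType) (f g : W -> R) :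
  continuous f -> continuous g -> continuous (fun w => f w + g w).
Proof. by move=> cf cg w; apply: cvgD; [exact: cf|exact: cg]. Qed.

Lemma fun_mulr_continuous (W : topologicalType) (f g : W -> R) :
  continuous f -> continuous g -> continuous (fun w => f w * g w).
Proof. by move=> cf cg w; apply: cvgM; [exact: cf|exact: cg]. Qed.

Lemma fun_oppr_continuous (W : topologicalType) (f : W -> R) :
  continuous f -> continuous (fun w => - f w).
Proof. by move=> cf w; apply: cvgN; exact: cf. Qed.

Lemma fun_minr_continuous (W : topologicalType) (f g : W -> R) :
  continuous f -> continuous g -> continuous (fun w => Num.min (f w) (g w)).
Proof. by move=> cf cg w; apply: continuous_min; [exact: cf|exact: cg]. Qed.

Lemma fun_maxr_continuous (W : topologicalType) (f g : W -> R) :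
  continuous f -> continuous g -> continuous (fun w => Num.max (f w) (g w)).
Proof. by move=> cf cg w; apply: continuous_max; [exact: cf|exact: cg]. Qed.

End continuity_facts.

Ltac solve_continuous :=
  lazymatch goal with
  | |- forall x, continuous_at x (fun w => @?a w + @?b w) =>
      refine (@fun_addr_continuous _ _ a b _ _); solve_continuous
  | |- forall x, continuous_at x (fun w => @?a w * @?b w) =>
      refine (@fun_mulr_continuous _ _ a b _ _); solve_continuous
  | |- forall x, continuous_at x (fun w => - @?a w) =>
      refine (@fun_oppr_continuous _ _ a _); solve_continuous
  | |- forall x, continuous_at x (fun w => Num.min (@?a w) (@?b w)) =>
      refine (@fun_minr_continuous _ _ a b _ _); solve_continuous
  | |- forall x, continuous_at x (fun w => Num.max (@?a w) (@?b w)) =>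
      refine (@fun_maxr_continuous _ _ a b _ _); solve_continuous
  | |- forall x, continuous_at x (fun w => fst w) => exact: fst_continuous
  | |- forall x, continuous_at x fst => exact: fst_continuous
  | |- forall x, continuous_at x snd => exact: snd_continuous
  | |- forall x, continuous_at x (fun w => snd w) => exact: snd_continuous
  | |- forall x, continuous_at x (fun w => w) => by move=> ?
  | |- forall x, continuous_at x id => by move=> ?
  | |- forall x, continuous_at x (fun _ => ?c) => exact: cst_continuous
  | |- forall x, continuous_at x (fun w => fun_of_matrix w _ _) =>
      exact: coord_continuous
  | |- _ => idtac
  end.

Section homotopy_group.
Context {R : realType}.

Definition cube k : set 'rV[R]_k := [set t | forall i, 0 <= t 0 i <= 1].

Definition cube_boundary k : set 'rV[R]_k :=
  [set t | cube t /\ exists i, t 0 i = 0 \/ t 0 i = 1].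

(* Only the values on the cube are relevant: two spheroids that agree on the
   cube are homotopic. *)
Record spheroid k (X : topologicalType) (x0 : X) := Spheroid {
  spheroid_fun :> 'rV[R]_k -> X;
  spheroid_continuous : {within @cube k, continuous spheroid_fun};
  spheroid_boundary : forall t, cube_boundary t -> spheroid_fun t = x0 }.
Arguments spheroid_continuous {k X x0} f : rename.

Definition homotopic k (X : topologicalType) (x0 : X) (f g : spheroid k x0) :=
  exists H : R * 'rV[R]_k -> X,
    [/\ {within `[0, 1] `*` @cube k, continuous H},
        forall t, cube t -> H (0, t) = f t,
        forall t, cube t -> H (1, t) = g t &
        forall (s : R) t, 0 <= s <= 1 -> cube_boundary t -> H (s, t) = x0].

Lemma closed_cube k : closed (@cube k).
Proof.
have -> : @cube k = \bigcap_(i in [set: 'I_k])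
    ([set t | 0 <= t 0 i] `&` [set t | t 0 i <= 1]).
  apply/seteqP; split=> [t ct i _|t ct i]; first by have /andP[] := ct i.
  by have [//= -> ->] := ct i I.
apply: closed_bigI => i _; apply: closedI.
- by apply: (closed_comp _ (@closed_ge _ 0)) => z _; exact: coord_continuous.
- by apply: (closed_comp _ (@closed_le _ 1)) => z _; exact: coord_continuous.
Qed.

Lemma closed_cylinder k : closed (`[0, 1] `*` @cube k : set (R * 'rV[R]_k)).
Proof.
have -> : (`[0, 1] `*` @cube k) = (fst @^-1` `[0, 1]) `&` (snd @^-1` @cube k)
    :> set (R * 'rV[R]_k) by [].
apply: closedI; apply: preimage_closed; [|exact: interval_closed| |exact: closed_cube].
  by move=> z _; exact: fst_continuous.
by move=> z _; exact: snd_continuous.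
Qed.

Section first_coordinate.
Context {m : nat}.
Implicit Types t : 'rV[R]_m.+1.

Definition set_coord0 t (a : R) : 'rV[R]_m.+1 :=
  \row_i if i == 0 then a else t 0 i.

Lemma set_coord0E t a : set_coord0 t a 0 0 = a.
Proof. by rewrite mxE eqxx. Qed.

Lemma set_coord0_id t : set_coord0 t (t 0 0) = t.
Proof. by apply/rowP => i; rewrite mxE; case: eqP => // ->. Qed.

Lemma set_coord0K t a b : set_coord0 (set_coord0 t a) b = set_coord0 t b.
Proof. by apply/rowP => i; rewrite !mxE; case: eqP. Qed.

Lemma set_coord0_cube t a : cube t -> 0 <= a <= 1 -> cube (set_coord0 t a).
Proof. by move=> ct a01 i; rewrite mxE; case: ifP. Qed.

Lemma set_coord0_boundary t a : cube t -> a = 0 \/ a = 1 ->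
  cube_boundary (set_coord0 t a).
Proof.
move=> ct a01; split.
  by apply: set_coord0_cube => //; case: a01 => ->; rewrite ?lexx ?ler01.
by exists 0; rewrite mxE eqxx.
Qed.

Lemma boundary_set_coord0 t a : cube_boundary t -> 0 <= a <= 1 ->
  (t 0 0 = 0 \/ t 0 0 = 1 -> a = 0 \/ a = 1) ->
  cube_boundary (set_coord0 t a).
Proof.
move=> [ct [i ti]] a01 ta; split; first exact: set_coord0_cube.
have [i0|i0] := eqVneq i 0; first by exists 0; rewrite set_coord0E; apply: ta; rewrite -i0.
by exists i; rewrite mxE (negbTE i0).
Qed.

Lemma set_coord0_continuous (Z : topologicalType) (a : Z -> R)
    (g : Z -> 'rV[R]_m.+1) : continuous a -> continuous g ->
  continuous (fun z => set_coord0 (g z) (a z)).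
Proof.
move=> ca cg; apply: row_continuous => i.
have -> : (fun z => set_coord0 (g z) (a z) 0 i) =
    if i == 0 then a else (fun z => g z 0 i).
  by apply/funext => z; rewrite mxE; case: ifP.
case: ifP => // _ z.
exact: (@continuous_comp _ _ _ g (fun M : 'rV[R]_m.+1 => M 0 i) z (cg z)
  (@coord_continuous _ _ _ _ _ _)).
Qed.

Lemma snd_coord0_continuous :
  continuous (fun z : R * 'rV[R]_m.+1 => z.2 0 0).
Proof.
exact: (@comp_continuous _ _ _ snd (fun M : 'rV[R]_m.+1 => M 0 0)
  (@snd_continuous _ _) (@coord_continuous _ _ _ _ _)).
Qed.

End first_coordinate.

Section homotopic_equivalence.
Context {k : nat} {X : topologicalType} {x0 : X}.
Implicit Types f g h : spheroid k x0.

Lemma homotopic_refl f : homotopic f f.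
Proof.
exists (fun z => f z.2); split=> // [|s t _]; last exact: spheroid_boundary.
apply: within_comp; last exact (spheroid_continuous f); last first.
  by move=> z [].
exact/continuous_subspaceT/snd_continuous.
Qed.

Lemma homotopic_sym f g : homotopic f g -> homotopic g f.
Proof.
move=> [H [cH H0 H1 Hb]]; exists (fun z => H (1 - z.1, z.2)); split=> /=.
- apply: within_comp; last exact cH; last first.
    by move=> z [/=]; rewrite !in_itv/= => z1 z2; split=> //=; lra.
  apply/continuous_subspaceT/pair_continuous; solve_continuous.
- by move=> t ct; rewrite subr0 H1.
- by move=> t ct; rewrite subrr H0.
- by move=> s t s01 bt; apply: Hb => //; lra.
Qed.

Lemma homotopic_trans g f h : homotopic f g -> homotopic g h -> homotopic f h.
Proof.
move=> [H [cH H0 H1 Hb]] [K [cK K0 K1 Kb]].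
exists (fun z => if z.1 <= 2^-1 then H (2 * z.1, z.2) else K (2 * z.1 - 1, z.2)).
split=> /=.
- apply: within_glue; [exact: closed_cylinder|exact: fst_continuous| | |].
  + apply: within_comp; last exact cH; last first.
      move=> z [[/=]]; rewrite !in_itv/= => z1 z2 z3.
      by split=> //=; lra.
    apply/continuous_subspaceT/pair_continuous; solve_continuous.
  + apply: within_comp; last exact cK; last first.
      move=> z [[/=]]; rewrite !in_itv/= => z1 z2 z3.
      by split=> //=; lra.
    apply/continuous_subspaceT/pair_continuous; solve_continuous.
  + move=> z [/= _ z2] ->; rewrite divff ?pnatr_eq0// subrr K0 // H1 //.
- by move=> t ct; rewrite mulr0 H0// ifT//; lra.
- move=> t ct; rewrite ifF; last by apply/negbTE; rewrite -ltNge; lra.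
  by rewrite -K1//; congr (K (_, _)); lra.
- move=> s t s01 bt; case: ifPn => [s2|]; first by apply: Hb => //; lra.
  by rewrite -ltNge => s2; apply: Kb => //; lra.
Qed.

End homotopic_equivalence.

Section spheroid_operations.
Context {m : nat} {X : topologicalType} {x0 : X}.
Implicit Types f g h : spheroid m.+1 x0.

Lemma spheroid_set_coord0 f (t : 'rV[R]_m.+1) a :
  cube t -> a = 0 \/ a = 1 -> f (set_coord0 t a) = x0.
Proof. by move=> ct a01; apply/spheroid_boundary/set_coord0_boundary. Qed.

Definition concat_fun (f g : 'rV[R]_m.+1 -> X) (t : 'rV[R]_m.+1) : X :=
  if t 0 0 <= 2^-1 then f (set_coord0 t (2 * t 0 0))
  else g (set_coord0 t (2 * t 0 0 - 1)).

Fact concat_continuous f g : {within @cube m.+1, continuous (concat_fun f g)}.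
Proof.
apply: within_glue; [exact: closed_cube|exact: coord_continuous| | |].
- apply: within_comp; last exact (spheroid_continuous f); last first.
    by move=> t [ct /= t2]; apply: set_coord0_cube => //; have := ct 0; lra.
  apply/continuous_subspaceT/set_coord0_continuous; solve_continuous.
- apply: within_comp; last exact (spheroid_continuous g); last first.
    by move=> t [ct /= t2]; apply: set_coord0_cube => //; have := ct 0; lra.
  apply/continuous_subspaceT/set_coord0_continuous; solve_continuous.
- move=> t ct tE; rewrite !spheroid_set_coord0 //; [left|right]; rewrite tE; lra.
Qed.

Fact concat_boundary f g t : cube_boundary t -> concat_fun f g t = x0.
Proof.
move=> bt; have ct := bt.1; have t01 := ct 0; rewrite /concat_fun.
case: ifPn => [t2|]; last rewrite -ltNge => t2.
  by apply/spheroid_boundary/boundary_set_coord0 => //; [lra|case=> ?; [left|]; lra].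
by apply/spheroid_boundary/boundary_set_coord0 => //; [lra|case=> ?; [|right]; lra].
Qed.

Definition concat f g : spheroid m.+1 x0 :=
  Spheroid (@concat_continuous f g) (@concat_boundary f g).

Definition reverse_fun (f : 'rV[R]_m.+1 -> X) (t : 'rV[R]_m.+1) : X :=
  f (set_coord0 t (1 - t 0 0)).

Fact reverse_continuous f : {within @cube m.+1, continuous (reverse_fun f)}.
Proof.
apply: within_comp; last exact (spheroid_continuous f); last first.
    by move=> t ct; apply: set_coord0_cube => //; have := ct 0; lra.
apply/continuous_subspaceT/set_coord0_continuous; solve_continuous.
Qed.

Fact reverse_boundary f t : cube_boundary t -> reverse_fun f t = x0.
Proof.
move=> bt; have ct := bt.1; have t01 := ct 0.
apply/spheroid_boundary/boundary_set_coord0 => //; first lra.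
by case=> ?; [right|left]; lra.
Qed.

Definition reverse f : spheroid m.+1 x0 :=
  Spheroid (@reverse_continuous f) (@reverse_boundary f).

Fact const_continuous : {within @cube m.+1, continuous (fun=> x0)}.
Proof. exact/continuous_subspaceT/cst_continuous. Qed.

Definition const_spheroid : spheroid m.+1 x0 :=
  Spheroid const_continuous (fun _ _ => erefl).

Lemma concat_homotopic f f' g g' :
  homotopic f f' -> homotopic g g' -> homotopic (concat f g) (concat f' g').
Proof.
move=> [H [cH H0 H1 Hb]] [K [cK K0 K1 Kb]].
exists (fun z : R * 'rV[R]_m.+1 => if z.2 0 0 <= 2^-1 then H (z.1, set_coord0 z.2 (2 * z.2 0 0))
   else K (z.1, set_coord0 z.2 (2 * z.2 0 0 - 1))); split=> /=.
- have c20 : continuous (fun z : R * 'rV[R]_m.+1 => z.2 0 0).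
    exact: snd_coord0_continuous.
  apply: within_glue => //; first exact: closed_cylinder.
  + apply: within_comp; last exact cH; last first.
      move=> z [[/= z1 ct] z3]; split=> //=.
      by apply: set_coord0_cube => //; have := ct 0; lra.
    apply/continuous_subspaceT/pair_continuous; first exact: fst_continuous.
    by apply: set_coord0_continuous; solve_continuous.
  + apply: within_comp; last exact cK; last first.
      move=> z [[/= z1 ct] z3]; split=> //=.
      by apply: set_coord0_cube => //; have := ct 0; lra.
    apply/continuous_subspaceT/pair_continuous; first exact: fst_continuous.
    by apply: set_coord0_continuous; solve_continuous.
  + move=> [s t] [/=]; rewrite in_itv/= => s01 ct tE; rewrite tE.
    rewrite Hb ?Kb//; apply: set_coord0_boundary => //; [left|right]; lra.
- move=> t ct; rewrite /concat_fun; have t01 := ct 0.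
  case: ifPn => [t2|]; last rewrite -ltNge => t2.
    by apply: H0; apply: set_coord0_cube => //; lra.
  by apply: K0; apply: set_coord0_cube => //; lra.
- move=> t ct; rewrite /concat_fun; have t01 := ct 0.
  case: ifPn => [t2|]; last rewrite -ltNge => t2.
    by apply: H1; apply: set_coord0_cube => //; lra.
  by apply: K1; apply: set_coord0_cube => //; lra.
- move=> s t s01 bt; have ct := bt.1; have t01 := ct 0.
  case: ifPn => [t2|]; last rewrite -ltNge => t2.
    by apply/Hb/boundary_set_coord0 => //; [lra|case=> ?; [left|]; lra].
  by apply/Kb/boundary_set_coord0 => //; [lra|case=> ?; [|right]; lra].
Qed.

Lemma reparam_homotopic f g h (p q : R -> R) :
  continuous p -> continuous q ->
  (forall a, 0 <= a <= 1 -> 0 <= p a <= 1 /\ 0 <= q a <= 1) ->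
  p 0 = q 0 -> p 1 = q 1 -> (q 0 = 0 \/ q 0 = 1) -> (q 1 = 0 \/ q 1 = 1) ->
  (forall t, cube t -> g t = f (set_coord0 t (p (t 0 0)))) ->
  (forall t, cube t -> h t = f (set_coord0 t (q (t 0 0)))) ->
  homotopic g h.
Proof.
move=> cp cq pq01 pq0 pq1 q0 q1 gE hE.
have conv (s a : R) : 0 <= s <= 1 -> 0 <= a <= 1 ->
    0 <= (1 - s) * p a + s * q a <= 1.
  by move=> s01 /pq01[pa qa]; apply/andP; split; nra.
exists (fun z : R * 'rV[R]_m.+1 => f (set_coord0 z.2
  ((1 - z.1) * p (z.2 0 0) + z.1 * q (z.2 0 0)))); split=> /=.
- apply: within_comp; last exact (spheroid_continuous f); last first.
    move=> [s t] [/=]; rewrite in_itv/= => s01 ct.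
    by apply: set_coord0_cube => //; apply: conv.
  apply/continuous_subspaceT/set_coord0_continuous; solve_continuous.
  + exact: (@comp_continuous _ _ _ _ p (@snd_coord0_continuous _)).
  + exact: (@comp_continuous _ _ _ _ q (@snd_coord0_continuous _)).
- by move=> t ct; rewrite subr0 mul1r mul0r addr0 gE.
- by move=> t ct; rewrite subrr mul1r mul0r add0r hE.
- move=> s t s01 bt; apply/spheroid_boundary/boundary_set_coord0 => //.
    by apply: conv => //; exact: bt.1.
  case=> ->; rewrite ?pq0 ?pq1 -mulrDl subrK mul1r //.
Qed.

Lemma concat_assoc f g h :
  homotopic (concat f (concat g h)) (concat (concat f g) h).
Proof.
apply: homotopic_sym.
apply: (@reparam_homotopic (concat f (concat g h)) _ _
  (fun a => Num.min (2 * a) (Num.min (a + 4^-1) ((a + 1) * 2^-1))) id).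
- by solve_continuous.
- by solve_continuous.
- by move=> a a01; rewrite !minEle; repeat case: ifP => /=; lra.
- by rewrite !minEle; repeat case: ifP => /=; lra.
- by rewrite !minEle; repeat case: ifP => /=; lra.
- by left.
- by right.
- move=> t ct; have := ct 0; rewrite /= /concat_fun !set_coord0E.
  move: (t 0 0) => a a01.
  set b := Num.min _ _.
  have : [\/ a <= 4^-1 /\ b = 2 * a, 4^-1 <= a <= 2^-1 /\ b = a + 4^-1 |
            2^-1 <= a /\ b = (a + 1) / 2].
    rewrite /b; case: (leP (a + 4^-1) ((a + 1) / 2)) => ?;
      rewrite minEle; case: ifPn; rewrite -?ltNge => ?;
    first [by apply: Or31; lra | by apply: Or32; lra | by apply: Or33; lra].
  move: b => b bE; rewrite !set_coord0K.
  case: bE => -[? ?]; repeat (case: ifPn; rewrite -?ltNge => ?);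
    first [ by exfalso; lra
          | by refine (congr1 (fun b => f (set_coord0 t b)) _); lra
          | by refine (congr1 (fun b => g (set_coord0 t b)) _); lra
          | by refine (congr1 (fun b => h (set_coord0 t b)) _); lra].
- by move=> t ct; rewrite set_coord0_id.
Qed.

Lemma concat_constl f : homotopic (concat const_spheroid f) f.
Proof.
apply: (@reparam_homotopic f _ _ (fun a => Num.max 0 (2 * a - 1)) id).
- by solve_continuous.
- by solve_continuous.
- by move=> a a01; rewrite !maxEle; repeat case: ifP => /=; lra.
- by rewrite !maxEle; repeat case: ifP => /=; lra.
- by rewrite !maxEle; repeat case: ifP => /=; lra.
- by left.
- by right.
- move=> t ct; have := ct 0; rewrite /= /concat_fun /=.
  have f0 := spheroid_set_coord0 f ct (or_introl erefl).
  move: (t 0 0) => a a01; rewrite !maxEle;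
  repeat (case: ifPn; rewrite -?ltNge => ?);
    first [ by exfalso; clear f0; lra
          | by refine (congr1 (fun b => f (set_coord0 t b)) _); clear f0; lra
          | by refine (etrans (esym f0) (congr1 (fun b => f (set_coord0 t b)) _)); lra].
- by move=> t ct; rewrite set_coord0_id.
Qed.

Lemma concat_constr f : homotopic (concat f const_spheroid) f.
Proof.
apply: (@reparam_homotopic f _ _ (fun a => Num.min (2 * a) 1) id).
- by solve_continuous.
- by solve_continuous.
- by move=> a a01; rewrite !minEle; repeat case: ifP => /=; lra.
- by rewrite !minEle; repeat case: ifP => /=; lra.
- by rewrite !minEle; repeat case: ifP => /=; lra.
- by left.
- by right.
- move=> t ct; have := ct 0; rewrite /= /concat_fun /=.
  have f1 := spheroid_set_coord0 f ct (or_intror erefl).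
  move: (t 0 0) => a a01; rewrite !minEle;
  repeat (case: ifPn; rewrite -?ltNge => ?);
    first [ by exfalso; clear f1; lra
          | by refine (congr1 (fun b => f (set_coord0 t b)) _); clear f1; lra
          | by refine (etrans (esym f1) (congr1 (fun b => f (set_coord0 t b)) _)); lra].
- by move=> t ct; rewrite set_coord0_id.
Qed.

Lemma concat_reverser f : homotopic (concat f (reverse f)) const_spheroid.
Proof.
apply: (@reparam_homotopic f _ _ (fun a => Num.min (2 * a) (2 - 2 * a)) (fun=> 0)).
- by solve_continuous.
- by solve_continuous.
- by move=> a a01; rewrite !minEle; repeat case: ifP => /=; lra.
- by rewrite !minEle; repeat case: ifP => /=; lra.
- by rewrite !minEle; repeat case: ifP => /=; lra.
- by left.
- by left.
- move=> t ct; have := ct 0; rewrite /= /concat_fun /= /reverse_fun.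
  rewrite !set_coord0E !set_coord0K.
  move: (t 0 0) => a a01; rewrite !minEle;
  repeat (case: ifPn; rewrite -?ltNge => ?);
    first [ by exfalso; lra
          | by refine (congr1 (fun b => f (set_coord0 t b)) _); lra].
- by move=> t ct; rewrite spheroid_set_coord0//; left.
Qed.

Lemma concat_reversel f : homotopic (concat (reverse f) f) const_spheroid.
Proof.
apply: (@reparam_homotopic f _ _
  (fun a => Num.max (1 - 2 * a) (2 * a - 1)) (fun=> 1)).
- by solve_continuous.
- by solve_continuous.
- by move=> a a01; rewrite !maxEle; repeat case: ifP => /=; lra.
- by rewrite !maxEle; repeat case: ifP => /=; lra.
- by rewrite !maxEle; repeat case: ifP => /=; lra.
- by right.
- by right.
- move=> t ct; have := ct 0; rewrite /= /concat_fun /= /reverse_fun.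
  rewrite !set_coord0E !set_coord0K.
  move: (t 0 0) => a a01; rewrite !maxEle;
  repeat (case: ifPn; rewrite -?ltNge => ?);
    first [ by exfalso; lra
          | by refine (congr1 (fun b => f (set_coord0 t b)) _); lra].
- by move=> t ct; rewrite spheroid_set_coord0//; right.
Qed.

End spheroid_operations.

Section group.
Variables (k : nat) (X : topologicalType) (x0 : X).

HB.instance Definition _ m := gen_eqMixin (spheroid m x0).
HB.instance Definition _ m := gen_choiceMixin (spheroid m x0).

Definition homotopic_rel m : rel (spheroid m x0) :=
  fun f g => `[< homotopic f g >].

Fact homotopic_rel_equiv m : equiv_class_of (@homotopic_rel m).
Proof.
split=> [f|f g|g f h].
- by apply/asboolP; exact: homotopic_refl.
- by apply/asboolP/asboolP; exact: homotopic_sym.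
- by move=> /asboolP fg /asboolP gh; apply/asboolP; exact: homotopic_trans gh.
Qed.

Canonical homotopic_equiv m := EquivRelPack (@homotopic_rel_equiv m).

(* The cube of dimension k.-1.+1 is the k-cube for every k >= 1, so that this is
   pi_k(X, x0) for k >= 1 and carries a group structure without a side condition
   on k; the case k = 0 (which repeats k = 1) is meaningless. *)
Definition homotopy_group := {eq_quot @homotopic_equiv k.-1.+1}.

HB.instance Definition _ := Choice.on homotopy_group.

Definition homotopy_class (f : spheroid k.-1.+1 x0) : homotopy_group :=
  \pi_homotopy_group f.

Lemma homotopy_classP f g :
  homotopy_class f = homotopy_class g <-> homotopic f g.
Proof. by split=> [/eqmodP/asboolP|fg] //; apply/eqmodP/asboolP. Qed.

Lemma homotopy_group_ind (P : homotopy_group -> Prop) :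
  (forall f, P (homotopy_class f)) -> forall a, P a.
Proof. by move=> Pf a; rewrite -(reprK a). Qed.

Definition homotopy_mul (a b : homotopy_group) : homotopy_group :=
  homotopy_class (concat (repr a) (repr b)).

Definition homotopy_inv (a : homotopy_group) : homotopy_group :=
  homotopy_class (reverse (repr a)).

Lemma homotopic_repr f : homotopic (repr (homotopy_class f)) f.
Proof. by apply/homotopy_classP; rewrite /homotopy_class reprK. Qed.

Lemma homotopy_mulE f g :
  homotopy_mul (homotopy_class f) (homotopy_class g) =
  homotopy_class (concat f g).
Proof. by apply/homotopy_classP/concat_homotopic; exact: homotopic_repr. Qed.

Fact homotopy_mulA : associative homotopy_mul.
Proof.
elim/homotopy_group_ind => f; elim/homotopy_group_ind => g.
elim/homotopy_group_ind => h; rewrite !homotopy_mulE.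
by apply/homotopy_classP; exact: concat_assoc.
Qed.

Fact homotopy_mul1 : left_id (homotopy_class (const_spheroid)) homotopy_mul.
Proof.
elim/homotopy_group_ind => f; rewrite homotopy_mulE.
by apply/homotopy_classP; exact: concat_constl.
Qed.

Fact homotopy_mulr1 : right_id (homotopy_class (const_spheroid)) homotopy_mul.
Proof.
elim/homotopy_group_ind => f; rewrite homotopy_mulE.
by apply/homotopy_classP; exact: concat_constr.
Qed.

Fact homotopy_mulV :
  left_inverse (homotopy_class (const_spheroid)) homotopy_inv homotopy_mul.
Proof.
move=> a; rewrite -{2}(reprK a) -/(homotopy_class _) homotopy_mulE.
by apply/homotopy_classP; exact: concat_reversel.
Qed.

Fact homotopy_mulrV :
  right_inverse (homotopy_class (const_spheroid)) homotopy_inv homotopy_mul.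
Proof.
move=> a; rewrite -{1}(reprK a) -/(homotopy_class _) homotopy_mulE.
by apply/homotopy_classP; exact: concat_reverser.
Qed.

HB.instance Definition _ := isGroup.Build homotopy_group
  homotopy_mulA homotopy_mul1 homotopy_mulr1 homotopy_mulV homotopy_mulrV.

End group.
End homotopy_group.

Arguments homotopy_group R k {X} x0.

Section direct_product.
Variables (I : Type) (G : I -> groupType).

Definition direct_product := forall i, G i.

HB.instance Definition _ := gen_eqMixin direct_product.
HB.instance Definition _ := gen_choiceMixin direct_product.

Let one : direct_product := fun=> 1%g.
Let inv (a : direct_product) : direct_product := fun i => (a i)^-1%g.
Let mul (a b : direct_product) : direct_product := fun i => (a i * b i)%g.

Let mulA : associative mul.
Proof. by move=> a b c; apply: functional_extensionality_dep => i; exact: mulgA. Qed.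
Let mul1 : left_id one mul.
Proof. by move=> a; apply: functional_extensionality_dep => i; exact: mul1g. Qed.
Let mulr1 : right_id one mul.
Proof. by move=> a; apply: functional_extensionality_dep => i; exact: mulg1. Qed.
Let mulV : left_inverse one inv mul.
Proof. by move=> a; apply: functional_extensionality_dep => i; exact: mulVg. Qed.
Let mulrV : right_inverse one inv mul.
Proof. by move=> a; apply: functional_extensionality_dep => i; exact: mulgV. Qed.

HB.instance Definition _ :=
  isGroup.Build direct_product mulA mul1 mulr1 mulV mulrV.

End direct_product.

Definition group_isomorphic (G H : groupType) :=
  exists F : {multiplicative G -> H}, bijective F.

Definition sphere (R : realType) n : set 'rV[R]_n.+1 :=
  [set x | \sum_i x 0 i ^+ 2 = 1].
Arguments sphere R n : clear implicits.

(* A linear isomorphism onto R^n transports the usual topology; the result does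
   not depend on the choice of the basis. *)
Definition euclidean (R : realType) (W : vectType R) : topologicalType :=
  initial_topology (fun w : W => \row_i coord (vbasis {:W}) i w).

Section tensor_product.
Context {R : realType} {d : nat} {V : 'I_d -> vectType R}.

Definition multilinear (U : lmodType R) (phi : (forall j, V j) -> U) :=
  forall (v : forall j, V j) (j : 'I_d) (a : R) (x y : V j),
    phi (dfwith v j (a *: x + y)) =
    a *: phi (dfwith v j x) + phi (dfwith v j y).

(* T, together with tau v = v_1 (x) ... (x) v_d, is a tensor product of the
   family V: it satisfies the universal property. *)
Definition is_tensor_product (T : vectType R) (tau : (forall j, V j) -> T) :=
  multilinear tau /\
  forall (U : lmodType R) (phi : (forall j, V j) -> U), multilinear phi ->
    exists h : {linear T -> U}, (forall v, h (tau v) = phi v) /\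
      forall h' : {linear T -> U}, (forall v, h' (tau v) = phi v) -> h' =1 h.

Definition rank_one (T : vectType R) (tau : (forall j, V j) -> T) :
    set (euclidean T) :=
  [set A | exists v : forall j, V j, (forall j, v j != 0) /\ A = tau v].

End tensor_product.

(* Main.v *)
(* The map [(v_1, ..., v_d) |-> v_1 (x) ... (x) v_d] from the product of the unit
   spheres to the rank-one tensors is, up to the contractible factor "norm of the
   tensor", a covering with finite fibres, the components of a tensor being unique
   up to signs; hence it induces isomorphisms on [pi_k] for [k >= 2].

   Lifting is done by hand. The form [inner], with
   [inner (u_1 (x) ... (x) u_d) (w_1 (x) ... (x) w_d) = \prod_j <u_j, w_j>], allows
   one to contract a tensor [A] against all but one of the unit components of a
   tensor [B]; if [inner B A > 0], the normalized results are unit components of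
   [A] that depend continuously on [A] and on those of [B]. Iterating this along the
   rays of a compact star-shaped set in [N] small steps lifts any map into the
   rank-one tensors. Signs are locally constant, so that a lift is determined by its
   value at a point, and for [k >= 2] the lift of a spheroid is a spheroid because
   the boundary of the cube is connected. Base points are matched by a suitable
   choice of the linear isomorphisms R^(n_j) -> V_j.

   For [k < m] a spheroid in the [m]-sphere is homotopic to a Lipschitz one, obtained
   by an infimal convolution; by a pigeonhole argument the latter misses a point,
   from which the sphere contracts to the base point. *)

From HB Require Import structures.
Require Import Defs.
From mathcomp Require Import all_boot all_order all_algebra.
From mathcomp Require Import all_classical all_reals topology normedtype.
From mathcomp Require Import interval_inference realfun ring lra.
Import Order.TTheory GRing.Theory Num.Theory.
Import numFieldNormedType.Exports.
Import VectorInternalTheory.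
Local Open Scope classical_set_scope.
Local Open Scope ring_scope.

Set Implicit Arguments.
Unset Strict Implicit.
Unset Printing Implicit Defensive.

(** * Topological preliminaries *)

Section topology_lemmas.
Context {R : realType}.

Lemma subtype_continuous (Z X : topologicalType) (A : set X) (f : Z -> A) :
  continuous (fun z => val (f z)) <-> continuous f.
Proof.
split=> cf; first exact: continuous_comp_initial.
by apply: comp_continuous => //; exact: initial_continuous.
Qed.

Lemma sum_continuous (Z : topologicalType) (I : Type) (r : seq I)
    (F : I -> Z -> R) :
  (forall i, continuous (F i)) -> continuous (fun z => \sum_(i <- r) F i z).
Proof. by move=> cF; apply: continuous_big => //; exact: add_continuous. Qed.

(* [A] is only known to be inhabited by [a]; outside of the preimage of [A] the
   value is the junk value [a]. *)
Definition to_subtype (Y : Type) (A : set Y) (a : A) (y : Y) : A :=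
  if pselect (A y) is left Ay then exist _ y (mem_set Ay) else a.

Lemma to_subtypeK (Y : Type) (A : set Y) (a : A) y : A y ->
  val (to_subtype a y) = y.
Proof. by rewrite /to_subtype; case: pselect. Qed.

Lemma to_subtype_continuous (Z X : topologicalType) (K : set Z) (A : set X)
    (a : A) (g : Z -> X) : (forall z, K z -> A (g z)) ->
  {within K, continuous g} -> {within K, continuous (fun z => to_subtype a (g z))}.
Proof.
move=> KA cg; apply/subtype_continuous.
by apply: subspace_eq_continuous cg => z; rewrite inE => /KA /(to_subtypeK a).
Qed.

(** A Lebesgue number argument: positivity at [(x, x)] spreads to a ball about [x], and compactness
    makes the radius uniform. It yields both the step size of the lifting and uniform continuity on
    the cube. *)
Lemma compact_near_diagonal (Z : normedModType R) (K : set Z) (g : Z * Z -> R) :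
  compact K -> {within K `*` K, continuous g} ->
  (forall z, K z -> 0 < g (z, z)) ->
  exists N : nat, forall x y, K x -> K y -> `|x - y| <= N.+1%:R^-1 -> 0 < g (x, y).
Proof.
move=> cK /subspace_continuousP cg gpos.
have : \forall n \near \oo, K `<=` fun x => K x -> forall y, K y ->
    `|x - y| <= n.+1%:R^-1 -> 0 < g (x, y).
  have /compact_near_coveringP := cK; apply => x Kx.
  have /= := cg (x, x) (conj Kx Kx) [set r | 0 < r].
  case; first by apply: (open_nbhs_nbhs (conj (@open_gt _ 0) _)); exact: gpos.
  move=> [U V] /= [/nbhs_ballP[e e0 eU] /nbhs_ballP[e' e'0 eV]] UVg.
  (* Half the smaller radius, as [y] is reached from [x] in two steps, each shorter than [r]: from
     [x] to [z] and from [z] to [y]. *)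
  pose r := Num.min e e' / 2.
  have r0 : 0 < r by rewrite divr_gt0 // lt_min e0.
  exists (ball x r, [set n | n.+1%:R^-1 < r]); first split => /=.
  - exact: nbhsx_ballx.
  - exact: near_infty_natSinv_lt (PosNum r0).
  move=> [z n] [/= xz nr] Kz y Ky zy.
  have rE : r + r = Num.min e e' by rewrite /r -splitr.
  apply: (UVg (z, y)) => //=; split.
    apply: eU; apply: le_ball xz.
    by apply: (@le_trans _ _ (r + r)); [rewrite lerDl ltW|rewrite rE ge_min lexx].
  apply: eV; rewrite -ball_normE /=.
  have -> : x - y = (x - z) + (z - y) by rewrite addrA subrK.
  apply: (le_lt_trans (ler_normD _ _)).
  apply: (@lt_le_trans _ _ (r + r)); last by rewrite rE ge_min lexx orbT.
  apply: ltrD; first by move: xz; rewrite -ball_normE.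
  exact: le_lt_trans nr.
move=> [N _ /(_ N (leqnn N)) KN]; exists N => x y Kx; exact: KN.
Qed.

(** On the segment [h] takes only the values 1 and -1; a change of sign would force the value 0 by
    the intermediate value theorem. *)
Lemma sign_segment (Z : normedModType R) (K : set Z) (h : Z -> R) (a b : Z) :
  {within K, continuous h} -> (forall z, K z -> h z ^+ 2 = 1) ->
  (forall s : R, 0 <= s <= 1 -> K (a + s *: (b - a))) -> h a = 1 -> h b = 1.
Proof.
move=> ch h1 Kab ha.
pose q (s : R) := h (a + s *: (b - a)).
have qab : q 0 = 1 /\ q 1 = h b.
  by rewrite /q scale0r addr0 scale1r addrC subrK ha.
have cq : {within `[0, 1], continuous q}.
  refine (within_comp _ _ ch); last by move=> s /=; rewrite in_itv /=; exact: Kab.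
  apply: continuous_subspaceT => s.
  apply: cvgD; first exact: cvg_cst.
  by apply: cvgZr_tmp; exact: cvg_id.
have q1 s : 0 <= s <= 1 -> q s = 1 \/ q s = -1.
  move=> /Kab/h1/eqP; rewrite sqrf_eq1 => /orP[]/eqP; [by left|by right].
have q11 := q1 1; have [|hb|hb] := q11; first by rewrite ler01 lexx.
  by rewrite -qab.2.
have [|c] := @IVT R q 0 1 0 ler01 cq.
  by rewrite qab.1 hb ge_min le_max; apply/andP; split; apply/orP; [right|left]; lra.
rewrite in_itv /= => /q1[] -> => /eqP; rewrite ?oppr_eq0 oner_eq0 //.
Qed.

End topology_lemmas.

(** * Multilinear maps, treated one slot at a time *)

Section multilinear_maps.
Context {R : realType} {d : nat}.

Section splicing.
Variable E : 'I_d -> Type.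
Implicit Types u b : forall j, E j.

(** An interpolation from [b] at [r = 0] to [u] at [r = d] that changes one slot per step;
    statements about all slots become inductions on [r]. *)
Definition splice r u b : forall j, E j := fun j => if (j < r)%N then u j else b j.

Lemma splice0 u b : splice 0 u b = b.
Proof. by []. Qed.

Lemma splice_full u b : splice d u b = u.
Proof. by apply: functional_extensionality_dep => j; rewrite /splice ltn_ord. Qed.

Lemma spliceS (j : 'I_d) u b : splice j.+1 u b = dfwith (splice j u b) j (u j).
Proof.
apply: functional_extensionality_dep => i; case: dfwithP => [|i' ji]; rewrite /splice.
  by rewrite ltnS leqnn.
by rewrite ltnS leq_eqVlt -val_eqE /= eq_sym in ji *; rewrite (negbTE ji).
Qed.

Lemma splice_dfwith (j : 'I_d) u b x :
  splice j u (dfwith b j x) = dfwith (splice j u b) j x.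
Proof.
apply: functional_extensionality_dep => i; case: dfwithP => [|i' ji]; rewrite /splice.
  by rewrite ltnn dfwithin.
by rewrite dfwithout.
Qed.

Lemma splice_ind (P : nat -> Prop) : P 0 -> (forall j : 'I_d, P j -> P j.+1) -> P d.
Proof.
move=> P0 PS; suff : forall r, (r <= d)%N -> P r by exact.
by elim=> // r IHr rd; apply: (PS (Ordinal rd)); apply: IHr; exact: ltnW.
Qed.

End splicing.

Section multilinear_slots.
Context {V : 'I_d -> vectType R} {U : lmodType R}.
Variable (phi : (forall j, V j) -> U).
Hypothesis phiM : multilinear phi.

Lemma multilinear0 v j : phi (dfwith v j 0) = 0.
Proof.
by have := phiM v (-1) (0 : V j) 0; rewrite scaler0 addr0 scaleN1r addNr.
Qed.

Lemma multilinearZ v j a (x : V j) : phi (dfwith v j (a *: x)) = a *: phi (dfwith v j x).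
Proof. by rewrite -[a *: x]addr0 phiM multilinear0 addr0. Qed.

Lemma multilinear_sum v j (I : Type) (r : seq I) (c : I -> R) (x : I -> V j) :
  phi (dfwith v j (\sum_(i <- r) c i *: x i)) =
  \sum_(i <- r) c i *: phi (dfwith v j (x i)).
Proof.
elim: r => [|i r IHr]; first by rewrite !big_nil multilinear0.
by rewrite !big_cons phiM IHr.
Qed.

Lemma multilinear_scale (c : 'I_d -> R) v :
  phi (fun j => c j *: v j) = (\prod_j c j) *: phi v.
Proof.
suff: phi (splice d (fun j => c j *: v j) v) = (\prod_(j < d | (j < d)%N) c j) *: phi v.
  by rewrite splice_full => ->; congr (_ *: _); apply: eq_bigl => j; rewrite ltn_ord.
apply: (splice_ind (P := fun r => phi (splice r (fun j => c j *: v j) v) =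
  (\prod_(j < d | (j < r)%N) c j) *: phi v)) => [|j IHj].
  by rewrite splice0 big_pred0// scale1r.
rewrite spliceS multilinearZ -splice_dfwith.
have -> : dfwith v j (v j) = v.
  by apply: functional_extensionality_dep => i; case: dfwithP.
rewrite IHj scalerA [in RHS](bigD1 j) //=; congr ((_ * _) *: _).
by apply: eq_bigl => i; rewrite ltnS ltn_neqAle -val_eqE andbC.
Qed.

Lemma multilinear_linear (W : lmodType R) (h : {linear U -> W}) :
  multilinear (fun v => h (phi v)).
Proof. by move=> v j a x y; rewrite phiM linearP. Qed.

Lemma multilinear_subst (V' : 'I_d -> vectType R)
    (h : forall j, {linear V' j -> V j}) :
  multilinear (fun v' => phi (fun j => h j (v' j))).
Proof.
move=> v j a x y; have E z : (fun i => h i (dfwith v j z i)) =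
    dfwith (fun i => h i (v i)) j (h j z).
  apply: functional_extensionality_dep => i; case: dfwithP => [|i' ji].
    by rewrite dfwithin.
  by rewrite dfwithout.
by rewrite !E linearP phiM.
Qed.

End multilinear_slots.

Lemma multilinear_continuous (Z : topologicalType) (p : 'I_d -> nat)
    (phi : (forall j, 'rV[R]_(p j)) -> R^o) (w : Z -> forall j, 'rV[R]_(p j)) :
  multilinear phi ->
  (forall j, continuous (w ^~ j)) -> continuous (fun z => phi (w z) : R).
Proof.
move=> phiM cw.
(* The base [b] is generalized because expanding slot [j] in the standard basis puts basis vectors
   into it. *)
suff: forall b, continuous (fun z => phi (splice d (w z) b) : R).
  move=> /(_ (fun=> 0)); have -> // : (fun z => phi (w z)) =
    fun z => phi (splice d (w z) (fun=> 0)).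
  by apply/funext => z; rewrite splice_full.
apply: (splice_ind (P := fun r => forall b,
  continuous (fun z => phi (splice r (w z) b) : R))) => [b|j IHj b].
  by move=> z; exact: cvg_cst.
have -> : (fun z => phi (splice j.+1 (w z) b) : R) =
    fun z => \sum_a w z j 0 a * (phi (splice j (w z) (dfwith b j (delta_mx 0 a))) : R).
  apply/funext => z; rewrite spliceS {1}[w z j]row_sum_delta.
  rewrite (multilinear_sum phiM); apply: eq_bigr => a _.
  by rewrite splice_dfwith.
apply: sum_continuous => a; apply: fun_mulr_continuous; last exact: IHj.
exact: (@comp_continuous _ _ _ (w ^~ j) (fun M => M 0 a) (cw j)
  (@coord_continuous _ _ _ _ _)).
Qed.

End multilinear_maps.

(** * The Euclidean topology in terms of linear forms *)

Section euclidean_topology.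
Context {R : realType} {W : vectType R}.

Lemma linear_continuous_euclidean (h : {linear W -> R^o}) :
  continuous (h : euclidean W -> R).
Proof.
have -> : (h : euclidean W -> R) = fun w =>
    \sum_i (\row_i coord (vbasis {:W}) i w : 'rV[R]_(\dim {:W})) 0 i *
      (h (vbasis {:W})`_i : R).
  apply/funext => w; rewrite {1}(coord_vbasis (memvf w)) linear_sum.
  by apply: eq_bigr => i _; rewrite linearZ mxE.
apply: sum_continuous => i; apply: fun_mulr_continuous; last exact: cst_continuous.
exact: (comp_continuous (@initial_continuous _ _
  (fun w : W => \row_i coord (vbasis {:W}) i w)) (@coord_continuous _ _ _ _ _)).
Qed.

(** The coordinates defining the topology are themselves linear forms, which gives a criterion that
    does not mention the basis. *)
Lemma euclidean_continuous (Z : topologicalType) (f : Z -> euclidean W) :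
  (forall h : {linear W -> R^o}, continuous (fun z => h (f z) : R)) -> continuous f.
Proof.
move=> cf; apply: continuous_comp_initial; apply: row_continuous => i.
have -> : (fun z => ((fun w : W => \row_i coord (vbasis {:W}) i w) \o f) z 0 i) =
    fun z => coord (vbasis {:W}) i (f z) by apply/funext => z; rewrite /= mxE.
exact: (cf (coord (vbasis {:W}) i)).
Qed.

Lemma euclidean_lincomb_continuous (Z : topologicalType) (a b : Z -> R)
    (f g : Z -> euclidean W) :
  continuous a -> continuous b -> continuous f -> continuous g ->
  continuous (fun z => a z *: (f z : W) + b z *: (g z : W) : euclidean W).
Proof.
move=> ca cb cf cg; apply: euclidean_continuous => h.
have -> : (fun z => h (a z *: (f z : W) + b z *: (g z : W)) : R) =
    fun z => a z * (h (f z) : R) + b z * (h (g z) : R).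
  by apply/funext => z; rewrite linearP linearZ.
have ch := @linear_continuous_euclidean h.
refine (@fun_addr_continuous _ _ (fun z => a z * (h (f z) : R))
  (fun z => b z * (h (g z) : R)) _ _).
  refine (@fun_mulr_continuous _ _ a (fun z => h (f z) : R) ca _).
  exact: (@comp_continuous _ _ _ f _ cf ch).
refine (@fun_mulr_continuous _ _ b (fun z => h (g z) : R) cb _).
exact: (@comp_continuous _ _ _ g _ cg ch).
Qed.

End euclidean_topology.

(** * The standard inner product and normalization of vectors *)

Definition dot {R : realType} {p : nat} (x y : 'rV[R]_p) : R :=
  \sum_i x 0 i * y 0 i.

Section dot_product.
Context {R : realType} {p : nat}.
Implicit Types x y z : 'rV[R]_p.

Lemma dotC x y : dot x y = dot y x.
Proof. by apply: eq_bigr => i _; rewrite mulrC. Qed.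

Lemma dotDl x y z : dot (x + y) z = dot x z + dot y z.
Proof. by rewrite -big_split; apply: eq_bigr => i _; rewrite mxE mulrDl. Qed.

Lemma dotZl a x y : dot (a *: x) y = a * dot x y.
Proof. by rewrite /dot mulr_sumr; apply: eq_bigr => i _; rewrite mxE mulrA. Qed.

Lemma dot0l x : dot 0 x = 0.
Proof. by rewrite -(scale0r 0) dotZl mul0r. Qed.

Lemma dotDr x y z : dot x (y + z) = dot x y + dot x z.
Proof. by rewrite !(dotC x) dotDl. Qed.

Lemma dotZr a x y : dot x (a *: y) = a * dot x y.
Proof. by rewrite !(dotC x) dotZl. Qed.

Lemma dotNl x y : dot (- x) y = - dot x y.
Proof. by rewrite -scaleN1r dotZl mulN1r. Qed.

Lemma dotNr x y : dot x (- y) = - dot x y.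
Proof. by rewrite dotC dotNl dotC. Qed.

Lemma dot_delta x i : dot x (delta_mx 0 i) = x 0 i.
Proof.
rewrite /dot (bigD1 i) //= mxE !eqxx mulr1 big1 ?addr0 // => j ji.
by rewrite mxE (negbTE ji) andbF mulr0.
Qed.

Lemma dot_ge0 x : 0 <= dot x x.
Proof. by apply: sumr_ge0 => i _; rewrite -expr2 sqr_ge0. Qed.

Lemma dot_eq0 x : (dot x x == 0) = (x == 0).
Proof.
apply/eqP/eqP => [|->]; last by rewrite dot0l.
move=> /psumr_eq0P x0; apply/rowP => i; rewrite mxE.
by apply/eqP; rewrite -sqrf_eq0 expr2 x0 // => j _; rewrite -expr2 sqr_ge0.
Qed.

Lemma dot_gt0 x : (0 < dot x x) = (x != 0).
Proof. by rewrite lt_def dot_ge0 andbT dot_eq0. Qed.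

(** For unit vectors, <x - y, x - y> = 2 - 2 <x, y>. *)
Lemma unit_eq x y : dot x x = 1 -> dot y y = 1 -> dot x y = 1 -> x = y.
Proof.
move=> xx yy xy; apply/eqP; rewrite -subr_eq0 -dot_eq0 dotDl !dotDr !dotNl !dotNr.
by rewrite (dotC y x) xx yy xy opprK subrr add0r addNr.
Qed.

Lemma unit_dot_lt1 x y : dot x x = 1 -> dot y y = 1 -> x != y -> dot x y < 1.
Proof.
move=> xx yy; rewrite -subr_eq0 -dot_gt0 dotDl !dotDr !dotNl !dotNr.
rewrite (dotC y x) xx yy; lra.
Qed.

Lemma dot_continuous (Z : topologicalType) (f g : Z -> 'rV[R]_p) :
  continuous f -> continuous g -> continuous (fun t => dot (f t) (g t)).
Proof.
move=> cf cg; apply: sum_continuous => i; apply: fun_mulr_continuous.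
  exact: (comp_continuous cf (@coord_continuous _ _ _ _ _)).
exact: (comp_continuous cg (@coord_continuous _ _ _ _ _)).
Qed.

Definition normalize x := (Num.sqrt (dot x x))^-1 *: x.

Lemma normalize_dot x : x != 0 -> dot (normalize x) (normalize x) = 1.
Proof.
move=> x0; rewrite dotZl dotZr mulrA -invfM -expr2 sqr_sqrtr ?dot_ge0 //.
by rewrite mulVf // dot_eq0.
Qed.

Lemma normalize_unit x c : dot x x = 1 -> 0 < c -> normalize (c *: x) = x.
Proof.
move=> xx c0; rewrite /normalize dotZl dotZr xx mulr1 -expr2 sqrtr_sqr gtr0_norm //.
by rewrite scalerA mulVf ?gt_eqF // scale1r.
Qed.

Lemma normalize_continuous (Z : topologicalType) (K : set Z) (f : Z -> 'rV[R]_p) :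
  {within K, continuous f} -> (forall t, K t -> f t != 0) ->
  {within K, continuous (fun t => normalize (f t))}.
Proof.
move=> cf f0; rewrite continuous_subspace_in => t /set_mem Kt.
apply: cvgZ; last exact: cf.
apply: cvgV; first by rewrite sqrtr_eq0 -ltNge dot_gt0 f0.
apply: continuous_comp; last exact: sqrt_continuous.
exact: dot_continuous.
Qed.

End dot_product.

(** * Rank-one tensors *)

Section tensor_inner_product.
Context {R : realType} {d : nat} {V : 'I_d -> vectType R} {T : vectType R}.
Variable tau : (forall j, V j) -> T.
Hypothesis htau : is_tensor_product tau.

(** The uniqueness half of the universal property, applied to the multilinear map [h] after
    [tau]. *)
Lemma tensor_ext (U : lmodType R) (g h : {linear T -> U}) :
  (forall v, g (tau v) = h (tau v)) -> g =1 h.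
Proof.
move=> gh A; have [_ /(_ U (fun v => h (tau v)))] := htau.
move=> /(_ (multilinear_linear htau.1 h))[k [_ kP]].
by rewrite (kP g gh) (kP h).
Qed.

Variable p : 'I_d -> nat.

Lemma multilinear_prod_dot (u : forall j, 'rV[R]_(p j)) :
  multilinear (fun w : forall j, 'rV[R]_(p j) => \prod_j dot (u j) (w j) : R^o).
Proof.
move=> w j a x y; have E z : \prod_i dot (u i) (dfwith w j z i) =
    dot (u j) z * \prod_(i | i != j) dot (u i) (w i).
  rewrite (bigD1 j) //= dfwithin; congr (_ * _); apply: eq_bigr => i ij.
  by rewrite dfwithout // eq_sym.
by rewrite !E dotDr dotZr mulrDl -mulrA.
Qed.

Variables (phi : forall j, {linear 'rV[R]_(p j) -> V j})
  (psi : forall j, {linear V j -> 'rV[R]_(p j)}).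
Hypothesis phiK : forall j, cancel (phi j) (psi j).

(** The universal property is used once per argument: for fixed [u] it gives a linear form [H u] on
    [T]; since [H u B] is multilinear in [u], it factors through [tau] again, which gives [G B]. The
    maps [psi j] read components in coordinates. *)
Lemma tensor_inner : exists inner : T -> {linear T -> R^o},
  (forall a A A' B, inner (a *: A + A') B = a * inner A B + inner A' B) /\
  forall u w : forall j, 'rV[R]_(p j),
    inner (tau (fun j => phi j (u j))) (tau (fun j => phi j (w j))) =
    \prod_j dot (u j) (w j).
Proof.
have /choice[H HE] : forall u : forall j, 'rV[R]_(p j),
    exists h : {linear T -> R^o},
      forall v, h (tau v) = \prod_j dot (u j) (psi j (v j)).
  move=> u; have [_ /(_ R^o (fun v => \prod_j dot (u j) (psi j (v j))))] := htau.
  case; first exact: (multilinear_subst (multilinear_prod_dot u) psi).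
  by move=> h [hE _]; exists h.
have HM B : multilinear (fun u => H u B : R^o).
  move=> u j a x y.
  pose g : {linear T -> R^o} := (a \*: H (dfwith u j x) \+ H (dfwith u j y))%R.
  apply: (tensor_ext (h := g)) => v; rewrite /g /= !HE.
  have E u' : \prod_i dot (u' i) (psi i (v i)) = \prod_i dot (psi i (v i)) (u' i).
    by apply: eq_bigr => i _; exact: dotC.
  by rewrite !E multilinear_prod_dot.
have /choice[G GE] : forall B : T, exists g : {linear T -> R^o},
    forall v, g (tau v) = H (fun j => psi j (v j)) B.
  move=> B; have [_ /(_ R^o (fun v => H (fun j => psi j (v j)) B))] := htau.
  case; first exact: (multilinear_subst (HM B) psi).
  by move=> h [hE _]; exists h.
exists G; split.
  move=> a A A' B.
  pose g : {linear T -> R^o} := (a \*: G A \+ G A')%R.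
  by apply: (tensor_ext (h := g)) => v; rewrite /g /= !GE linearP.
move=> u w; rewrite GE HE; apply: eq_bigr => j _; rewrite !phiK dotC //.
Qed.

End tensor_inner_product.

(** * Unit components of rank-one tensors and lifting of maps *)

Section rank_one_lifting.
Context {R : realType} {d : nat} {T : vectType R} {p : 'I_d -> nat}.
Variables (sigma : (forall j, 'rV[R]_(p j)) -> T) (inner : T -> {linear T -> R^o}).
Hypothesis sigmaM : multilinear sigma.
Hypothesis innerP : forall a A A' B, inner (a *: A + A') B = a * inner A B + inner A' B.
Hypothesis inner_sigma : forall u w,
  inner (sigma u) (sigma w) = \prod_j dot (u j) (w j).
Implicit Types (A B : T) (u v w : forall j, 'rV[R]_(p j)).

Lemma innerZl a A B : inner (a *: A) B = a * inner A B.
Proof.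
have inner0 : inner 0 B = 0 by have := innerP (-1) 0 0 B; rewrite scaler0 addr0; lra.
by rewrite -[a *: A]addr0 innerP inner0 addr0.
Qed.

Lemma inner_suml (I : Type) (r : seq I) (c : I -> R) (A : I -> T) B :
  inner (\sum_(i <- r) c i *: A i) B = \sum_(i <- r) c i * inner (A i) B.
Proof.
elim: r => [|i r IHr]; last by rewrite !big_cons innerP IHr.
by rewrite !big_nil -(scale0r 0) innerZl mul0r.
Qed.

Lemma inner_continuous (Z : topologicalType) (f g : Z -> euclidean T) :
  continuous f -> continuous g -> continuous (fun z => inner (f z) (g z) : R).
Proof.
move=> cf cg.
have -> : (fun z => inner (f z) (g z) : R) = fun z =>
    \sum_i (coord (vbasis {:T}) i (f z) : R) * (inner (vbasis {:T})`_i (g z) : R).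
  by apply/funext => z; rewrite {1}(coord_vbasis (memvf (f z : T))) inner_suml.
apply: sum_continuous => i.
refine (@fun_mulr_continuous _ _ (fun z => coord (vbasis {:T}) i (f z) : R) _ _ _).
  exact: (@comp_continuous _ _ _ f _ cf
    (@linear_continuous_euclidean _ _ (coord (vbasis {:T}) i))).
exact: (@comp_continuous _ _ _ g _ cg (@linear_continuous_euclidean _ _ _)).
Qed.

Lemma sigma_continuous (Z : topologicalType) (w : Z -> forall j, 'rV[R]_(p j)) :
  (forall j, continuous (w ^~ j)) -> continuous (fun z => sigma (w z) : euclidean T).
Proof.
move=> cw; apply: euclidean_continuous => h.
exact: (multilinear_continuous (multilinear_linear sigmaM h)).
Qed.

(** The [u j] are unit components of [A]; the factor [c] is the norm of [A] with respect to [inner].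
    Requiring [c] to be positive ties the signs of the components together. *)
Definition represents A u :=
  (forall j, dot (u j) (u j) = 1) /\ exists2 c, 0 < c & A = c *: sigma u.

(** The vector representing the linear form that sends [x] to [inner A] of the tensor with [x] in
    slot [j] and the components of [u] elsewhere. *)
Definition contract A u j : 'rV[R]_(p j) :=
  \row_a (inner A (sigma (dfwith u j (delta_mx 0 a))) : R).

Lemma contractZ c A u j : contract (c *: A) u j = c *: contract A u j.
Proof. by apply/rowP => a; rewrite !mxE innerZl. Qed.

Lemma contract_sigma v u j :
  contract (sigma v) u j = (\prod_(i | i != j) dot (v i) (u i)) *: v j.
Proof.
apply/rowP => a; rewrite !mxE inner_sigma (bigD1 j) //= dfwithin dot_delta mulrC.
by congr (_ * _); apply: eq_bigr => i ij; rewrite dfwithout // eq_sym.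
Qed.

Lemma contract_continuous (Z : topologicalType) (f : Z -> euclidean T)
    (w : Z -> forall j, 'rV[R]_(p j)) j :
  continuous f -> (forall i, continuous (w ^~ i)) ->
  continuous (fun z => contract (f z) (w z) j).
Proof.
move=> cf cw; apply: row_continuous => a.
have -> : (fun z => contract (f z) (w z) j 0 a) = fun z =>
    inner (f z) (sigma (dfwith (w z) j (delta_mx 0 a))) : R.
  by apply/funext => z; rewrite mxE.
apply: inner_continuous => //; apply: sigma_continuous => i.
have [<-|ji] := eqVneq j i.
  have -> : (fun z => dfwith (w z) j (delta_mx 0 a) j) = fun=> delta_mx 0 a.
    by apply/funext => z; rewrite dfwithin.
  exact: cst_continuous.
have -> : (fun z => dfwith (w z) j (delta_mx 0 a) i) = w ^~ i.
  by apply/funext => z; rewrite dfwithout.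
exact: cw.
Qed.

Lemma represents_contract A u : represents A u ->
  exists2 c, 0 < c & forall j, contract A u j = c *: u j.
Proof.
move=> [u1 [c c0 ->]]; exists c => // j.
by rewrite contractZ contract_sigma big1 ?scale1r.
Qed.

(** Contracting [A] against [u] gives a multiple of [u j], and also a multiple of [w j];
    proportional unit vectors differ by a sign. *)
Lemma represents_sign A u w : represents A u -> represents A w ->
  forall j, dot (u j) (w j) ^+ 2 = 1.
Proof.
move=> uA [w1 [c' c'0 AE]] j; have [c c0 /(_ j)] := represents_contract uA.
rewrite AE contractZ contract_sigma scalerA; set e := c' * _ => eE.
have {eE}uE : u j = (c^-1 * e) *: w j.
  by rewrite -scalerA eE scalerA mulVf ?gt_eqF // scale1r.
have := uA.1 j; rewrite uE !dotZl dotZr w1 !mulr1 => <-.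
by rewrite expr2.
Qed.

(* Contracting [A] against all but one of the components of a nearby tensor
   recovers the components of [A] up to scalars, hence a continuous choice of
   the signs of the unit components. *)
Definition transport A u j := normalize (contract A u j).

Lemma transport_represents A u v : represents A u -> 0 < inner A (sigma v) ->
  (forall j, contract (sigma v) u j != 0) /\
  represents (sigma v) (transport (sigma v) u).
Proof.
move=> [u1 [c c0 ->]]; rewrite innerZl inner_sigma pmulr_rgt0 //.
under eq_bigr do rewrite dotC; set P := \prod_j _ => P0.
pose b j := \prod_(i | i != j) dot (v i) (u i).
have PE j : P = dot (v j) (u j) * b j by rewrite /P (bigD1 j).
have b0 j : b j != 0.
  by apply/eqP => bj; move: P0; rewrite (PE j) bj mulr0 ltxx.
have v0 j : v j != 0.
  by apply/eqP => vj; move: P0; rewrite (PE j) vj dot0l mul0r ltxx.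
have bv0 j : contract (sigma v) u j != 0.
  by rewrite contract_sigma scaler_eq0 negb_or b0 v0.
split=> //; split=> [j|]; first exact: normalize_dot.
pose k j := Num.sqrt (dot (contract (sigma v) u j) (contract (sigma v) u j)).
have k0 j : 0 < k j by rewrite sqrtr_gt0 dot_gt0.
(* Single factors may be negative. Multiplied by <v_j, u_j>, however, each becomes k_j P / b_j^2 >
   0, so the product times [P] is positive, and [P] is positive. *)
exists (\prod_j (k j / b j)).
  rewrite -(pmulr_lgt0 _ P0) -big_split prodr_gt0 // => j _ /=.
  have -> : k j / b j * dot (v j) (u j) = k j * P / (b j) ^+ 2.
    by rewrite (PE j); field.
  by apply: divr_gt0; [exact: mulr_gt0|rewrite exprn_even_gt0 //= b0].
rewrite -(multilinear_scale sigmaM); congr sigma.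
apply: functional_extensionality_dep => j.
rewrite /transport /normalize -/(k j) contract_sigma !scalerA -/(b j).
have -> : k j / b j * (k j)^-1 * b j = 1 by field; rewrite b0 gt_eqF.
by rewrite scale1r.
Qed.

Lemma lift_rank_one (Z : normedModType R) (K : set Z) (f : Z -> euclidean T) u0 :
  compact K -> K 0 -> (forall z, K z -> `|z| <= 1) ->
  (forall (s : R) z, 0 <= s <= 1 -> K z -> K (s *: z)) ->
  {within K, continuous f} ->
  (forall z, K z -> exists v, (forall j, v j != 0) /\ f z = sigma v) ->
  represents (f 0) u0 ->
  exists w : Z -> forall j, 'rV[R]_(p j),
    [/\ forall j, {within K, continuous (w ^~ j)},
        forall z, K z -> represents (f z) (w z) & w 0 = u0].
Proof.
move=> cK K0 K1 Ks cf fX fu0.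
(* On the diagonal [inner] is a squared norm, hence positive; [N] is such that it stays positive
   between values of [f] at points of distance at most 1/(N+1). *)
have [|z Kz|N NP] := @compact_near_diagonal R Z K (fun z => inner (f z.1) (f z.2)) cK.
- apply: inner_continuous.
  + refine (within_comp _ _ cf); last by move=> z [].
    exact/continuous_subspaceT/fst_continuous.
  + refine (within_comp _ _ cf); last by move=> z [].
    exact/continuous_subspaceT/snd_continuous.
- have [v [v0 ->]] := fX z Kz; rewrite inner_sigma.
  by apply: prodr_gt0 => j _; rewrite dot_gt0.
pose q (i : nat) : R := i%:R / N.+1%:R.
have q01 i : (i <= N.+1)%N -> 0 <= q i <= 1.
  by move=> iN; rewrite divr_ge0 //= ler_pdivrMr ?ltr0n // mul1r ler_nat.
(* Induction on the number of steps along the rays: the shrunk map sending [z] to [f (q i *: z)] is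
   lifted on all of [K], and [q N.+1] is 1. *)
suff: forall i, (i <= N.+1)%N -> exists w : Z -> forall j, 'rV[R]_(p j),
    [/\ forall j, {within K, continuous (w ^~ j)},
        forall z, K z -> represents (f (q i *: z)) (w z) & w 0 = u0].
  move=> /(_ N.+1 (leqnn _))[w [cw wP w0]]; exists w; split=> // z /wP.
  by rewrite /q divff ?pnatr_eq0 // scale1r.
elim=> [_|i IHi iN].
  exists (fun=> u0); split=> // [j|z Kz]; first exact/continuous_subspaceT/cst_continuous.
  by rewrite /q mul0r scale0r.
have [w [cw wP w0]] := IHi (ltnW iN).
have step z : K z -> (forall j, contract (f (q i.+1 *: z)) (w z) j != 0) /\
    represents (f (q i.+1 *: z)) (transport (f (q i.+1 *: z)) (w z)).
  move=> Kz; have Kq := Ks _ _ (q01 _ iN) Kz.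
  have [v [v0 fE]] := fX _ Kq; rewrite fE.
  apply: (transport_represents (wP z Kz)); rewrite -fE.
  have /= := NP (q i *: z) (q i.+1 *: z); apply => //.
    by apply: Ks => //; apply: q01; exact: ltnW.
  rewrite -scalerBl normrZ distrC /q -mulrBl -natrB // subSnn mul1r normfV normr_nat.
  by rewrite ler_piMr // K1.
exists (fun z => transport (f (q i.+1 *: z)) (w z)); split=> [j|z /step[]//|].
  apply: normalize_continuous => [|z /step[]//].
  apply: contract_continuous => //; refine (within_comp _ _ cf).
    by apply: continuous_subspaceT => z; apply: cvgZl_tmp; exact: cvg_id.
  by move=> z; apply: Ks; exact: q01.
(* Over the centre [f 0] does not move, and transporting [u0] along a tensor that it represents
   returns [u0]. *)
apply: functional_extensionality_dep => j; rewrite scaler0 w0 /transport.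
by have [c c0 ->] := represents_contract fu0; rewrite normalize_unit // fu0.1.
Qed.

End rank_one_lifting.

(** * Homotopy groups of the rank-one tensors *)

Section cubes.
Context {R : realType} {k : nat}.
Implicit Types t : 'rV[R]_k.
Local Notation cylinder := (`[0, 1] `*` @cube R k : set (R * 'rV[R]_k)).

Lemma cube_convex t t' (r : R) : cube t -> cube t' -> 0 <= r <= 1 ->
  cube (t + r *: (t' - t)).
Proof.
move=> ct ct' r01 i; rewrite !mxE; have := ct i; have := ct' i.
by move: (t 0 i) (t' 0 i) => a b; nra.
Qed.

Lemma cube0 : @cube R k 0.
Proof. by move=> i; rewrite mxE lexx ler01. Qed.

Lemma cube_scale t (r : R) : cube t -> 0 <= r <= 1 -> cube (r *: t).
Proof.
by move=> ct r01; have := cube_convex cube0 ct r01; rewrite add0r subr0.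
Qed.

Lemma compact_cube : compact (@cube R k).
Proof.
have := @rV_compact R k (fun=> `[0, 1]%classic)
  (fun=> @segment_compact _ _ _).
by congr compact; apply/seteqP; split=> t ct i; have /= := ct i; rewrite in_itv.
Qed.

Lemma in_cylinder (r : R) t : 0 <= r <= 1 -> cube t -> cylinder (r, t).
Proof. by move=> r01 ct; split => //=; rewrite in_itv. Qed.

Lemma compact_cylinder : compact cylinder.
Proof. by apply: compact_setX; [exact: segment_compact|exact: compact_cube]. Qed.

Lemma rV_norm_le t (e : R) : 0 <= e -> (forall i, `|t 0 i| <= e) -> `|t| <= e.
Proof.
move=> e0 te; rewrite -[`|t|]/(mx_norm t) mx_normrE; apply/bigmax_leP; split=> // -[i j] _ /=.
by rewrite ord1 te.
Qed.

(** All norms here are maximum norms, so the cylinder fits into the unit ball, as the lifting lemma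
    demands. *)
Lemma cylinder_norm z : cylinder z -> `|z| <= 1.
Proof.
move=> [/=]; rewrite in_itv /= => s01 ct.
rewrite prod_normE ge_max; apply/andP; split; first by rewrite ger0_norm; lra.
by apply: rV_norm_le => // i; have := ct i; move=> ?; rewrite ger0_norm; lra.
Qed.

Lemma cylinder_scale (r : R) z : 0 <= r <= 1 -> cylinder z -> cylinder (r *: z).
Proof.
move=> r01 [/=]; rewrite in_itv /= => s01 ct; split => /=; last exact: cube_scale.
rewrite in_itv /=; change (0 <= r * z.1 <= 1).
by move: (z.1) s01 => s s01; apply/andP; split; nra.
Qed.

End cubes.

Lemma homotopic_ext (R : realType) k (X : topologicalType) (x0 : X)
    (f g : @spheroid R k X x0) : (forall t, cube t -> f t = g t) -> homotopic f g.
Proof.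
move=> fg; exists (fun z => f z.2); split=> // [|s t _]; last exact: spheroid_boundary.
refine (within_comp _ _ (@spheroid_continuous _ _ _ _ f)); last by move=> z [].
exact/continuous_subspaceT/snd_continuous.
Qed.

(** This lets homotopies in a subset be given by formulas in the ambient space. *)
Lemma homotopic_subtype (R : realType) k (Y : topologicalType) (A : set Y) (a : A)
    (f g : @spheroid R k _ a) (G : R * 'rV[R]_k -> Y) :
  {within `[0, 1] `*` @cube R k, continuous G} ->
  (forall z, (`[0, 1] `*` @cube R k) z -> A (G z)) ->
  (forall t, cube t -> G (0, t) = val (f t)) ->
  (forall t, cube t -> G (1, t) = val (g t)) ->
  (forall r t, 0 <= r <= 1 -> cube_boundary t -> G (r, t) = val a) ->
  homotopic f g.
Proof.
move=> cG GA G0 G1 Gb.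
have GE r t : 0 <= r <= 1 -> cube t -> val (to_subtype a (G (r, t))) = G (r, t).
  by move=> r01 ct; apply/to_subtypeK/GA/in_cylinder.
exists (fun z => to_subtype a (G z)); split; first exact: to_subtype_continuous.
- by move=> t ct; apply: val_inj; rewrite GE ?lexx ?ler01 // G0.
- by move=> t ct; apply: val_inj; rewrite GE ?lexx ?ler01 // G1.
- by move=> r t r01 bt; apply: val_inj; rewrite GE ?Gb //; exact: bt.1.
Qed.

(** The natural map, tensoring spheroids, goes from the product to the homotopy group of the
    tensors; the isomorphism sought goes the other way. *)
Lemma group_isomorphic_inv (G H : groupType) (F : H -> G) :
  {morph F : x y / (x * y)%g} -> injective F -> (forall y, exists x, F x = y) ->
  group_isomorphic G H.
Proof.
move=> FM Finj /choice[F' FK].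
have F'M : {morph F' : x y / (x * y)%g}.
  by move=> x y; apply: Finj; rewrite FM !FK.
pose F'mixin := isMultiplicative.Build G H F' F'M.
pose F'' : {multiplicative G -> H} := HB.pack F' F'mixin.
by exists F''; exists F => //= x; apply: Finj; rewrite FK.
Qed.

(** * The isomorphism induced by tensoring spheroids *)

Section rank_one_homotopy.
Context {R : realType} {d : nat} {T : vectType R} {m : 'I_d -> nat}.
Variables (sigma : (forall j, 'rV[R]_(m j).+1) -> T) (inner : T -> {linear T -> R^o}).
Hypothesis sigmaM : multilinear sigma.
Hypothesis innerP : forall a A A' B, inner (a *: A + A') B = a * inner A B + inner A' B.
Hypothesis inner_sigma : forall u w,
  inner (sigma u) (sigma w) = \prod_j dot (u j) (w j).
Variables (X : set (euclidean T)) (j0 : 'I_d).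
Hypothesis XP : forall A : T, X A <-> exists v, (forall j, v j != 0) /\ A = sigma v.
Variables (s : forall j, sphere R (m j)) (A0 : X).
Hypothesis A0E : val A0 = sigma (fun j => val (s j)) :> T.

Local Notation represents := (@represents R d T _ sigma).
Local Notation cylinder k := (`[0, 1] `*` @cube R k : set (R * 'rV[R]_k)).

Lemma sphere_dot n (x : sphere R n) : dot (val x) (val x) = 1.
Proof. by have /set_mem /= := valP x; apply: etrans; apply: eq_bigr => i _. Qed.

Lemma dot_sphere n (x : 'rV[R]_n.+1) : dot x x = 1 -> sphere R n x.
Proof. by apply: etrans; apply: eq_bigr => i _. Qed.

Lemma unit_neq0 n (x : 'rV[R]_n) : dot x x = 1 -> x != 0.
Proof. by move=> x1; rewrite -dot_gt0 x1 ltr01. Qed.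

Lemma X_scale c (u : forall j, 'rV[R]_(m j).+1) : 0 < c ->
  (forall j, u j != 0) -> X (c *: sigma u).
Proof.
(* The scalar is absorbed into the single slot [j0]. *)
move=> c0 u0; apply/XP; exists (fun j => (if j == j0 then c else 1) *: u j); split.
  move=> j; rewrite scaler_eq0 negb_or u0 andbT; case: ifP => _; last exact: oner_neq0.
  by rewrite gt_eqF.
rewrite (multilinear_scale sigmaM); congr (_ *: _).
by rewrite (bigD1 j0) //= eqxx big1 ?mulr1 // => j /negbTE ->.
Qed.

Lemma X_sigma (x : forall j, sphere R (m j)) : X (sigma (fun j => val (x j))).
Proof. by apply/XP; eexists; split=> // j; exact/unit_neq0/sphere_dot. Qed.

Lemma represents_sphere (x : forall j, sphere R (m j)) :
  represents (sigma (fun j => val (x j))) (fun j => val (x j)).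
Proof. by split=> [j|]; [exact: sphere_dot|exists 1; rewrite ?scale1r]. Qed.

Definition tensor_map {Y : Type} (x : forall j, Y -> sphere R (m j)) (y : Y) : X :=
  to_subtype A0 (sigma (fun j => val (x j y))).

Lemma val_tensor_map Y (x : forall j, Y -> sphere R (m j)) y :
  val (tensor_map x y) = sigma (fun j => val (x j y)).
Proof. by rewrite to_subtypeK //; exact: X_sigma. Qed.

Lemma tensor_map_continuous (Z : topologicalType) (K : set Z)
    (x : forall j, Z -> sphere R (m j)) :
  (forall j, {within K, continuous (x j)}) -> {within K, continuous (tensor_map x)}.
Proof.
move=> cx; apply: to_subtype_continuous => [z _|]; first exact: X_sigma.
by apply: (sigma_continuous sigmaM) => j; apply/subtype_continuous; exact: cx.
Qed.

Lemma tensor_map_base Y (x : forall j, Y -> sphere R (m j)) y :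
  (forall j, x j y = s j) -> tensor_map x y = A0.
Proof.
move=> xs; apply: val_inj; rewrite val_tensor_map A0E; congr sigma.
by apply: functional_extensionality_dep => j; rewrite xs.
Qed.

Section spheroids.
Variable k : nat.

Fact tensor_spheroid_continuous (f : forall j, @spheroid R k _ (s j)) :
  {within @cube R k, continuous (tensor_map (fun j => f j))}.
Proof. by apply: tensor_map_continuous => j; exact: spheroid_continuous. Qed.

Fact tensor_spheroid_boundary (f : forall j, @spheroid R k _ (s j)) t :
  cube_boundary t -> tensor_map (fun j => f j) t = A0.
Proof. by move=> bt; apply: tensor_map_base => j; exact: spheroid_boundary. Qed.

Definition tensor_spheroid (f : forall j, @spheroid R k _ (s j)) : @spheroid R k _ A0 :=
  Spheroid (@tensor_spheroid_continuous f) (@tensor_spheroid_boundary f).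

Lemma tensor_spheroid_homotopic (f g : forall j, @spheroid R k _ (s j)) :
  (forall j, homotopic (f j) (g j)) -> homotopic (tensor_spheroid f) (tensor_spheroid g).
Proof.
move=> fg; pose H j := sval (cid (fg j)).
have HP j := svalP (cid (fg j)).
exists (tensor_map H); split.
- by apply: tensor_map_continuous => j; have [] := HP j.
- move=> t ct /=; apply: val_inj; rewrite !val_tensor_map; congr sigma.
  by apply: functional_extensionality_dep => j; rewrite /H; have [_ -> //] := HP j.
- move=> t ct /=; apply: val_inj; rewrite !val_tensor_map; congr sigma.
  by apply: functional_extensionality_dep => j; rewrite /H; have [_ _ -> //] := HP j.
- by move=> r t r01 bt; apply: tensor_map_base => j; rewrite /H; have [_ _ _ ->] := HP j.
Qed.

End spheroids.

Lemma tensor_concat k (f g : forall j, @spheroid R k.+1 _ (s j)) :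
  homotopic (tensor_spheroid (fun j => concat (f j) (g j)))
    (concat (tensor_spheroid f) (tensor_spheroid g)).
Proof.
apply: homotopic_ext => t _ /=; rewrite /concat_fun /= /tensor_map /concat_fun.
by case: ifP.
Qed.

(** Two lifts differ by signs <u_j, w_j>, which are constant along the segments from 0 to the points
    of the cube. *)
Lemma lift_unique k (f : 'rV[R]_k -> T) (u w : 'rV[R]_k -> forall j, 'rV[R]_(m j).+1) :
  (forall j, {within @cube R k, continuous (u ^~ j)}) ->
  (forall j, {within @cube R k, continuous (w ^~ j)}) ->
  (forall t, cube t -> represents (f t) (u t)) ->
  (forall t, cube t -> represents (f t) (w t)) ->
  u 0 = w 0 -> forall t, cube t -> forall j, u t j = w t j.
Proof.
move=> cu cw uP wP uw0 t ct j.
apply: unit_eq; rewrite ?(uP t ct).1 ?(wP t ct).1 //.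
apply: (@sign_segment R _ (@cube R k) (fun t => dot (u t j) (w t j)) 0 t).
- exact: dot_continuous.
- move=> z cz; exact: (represents_sign innerP inner_sigma (uP z cz) (wP z cz)).
- by move=> r r01; apply: cube_convex => //; exact: cube0.
- by rewrite uw0 (wP _ cube0).1.
Qed.

(* Dimension at least 2 makes the boundary of the cube connected. *)
Lemma boundary_sign k (h : R * 'rV[R]_k.+2 -> R) :
  {within `[0, 1] `*` @cube_boundary R k.+2, continuous h} ->
  (forall z, (`[0, 1] `*` @cube_boundary R k.+2) z -> h z ^+ 2 = 1) ->
  h 0 = 1 ->
  forall r t, 0 <= r <= 1 -> cube_boundary t -> h (r, t) = 1.
Proof.
move=> ch h1 h0 r t r01 [ct [i ti]].
(* The path runs from (0, 0) to (0, e) and on to (r, t). On the first piece a coordinate other than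
   [i] stays 0; on the second, coordinate [i] keeps its value 0 or 1. Both therefore stay over the
   boundary. *)
pose e : 'rV[R]_k.+2 := \row_a if a == i then t 0 i else 0.
have eE a : e 0 a = if a == i then t 0 i else 0 by rewrite mxE.
move: e eE => e eE.
have ce : cube e.
  by move=> a; rewrite eE; case: ifP => _; [exact: ct|rewrite lexx ler01].
apply: (sign_segment (a := (0, e)) ch h1).
  move=> q q01; split => /=.
    rewrite in_itv /= add0r subr0; change (0 <= q * r <= 1).
    by apply/andP; split; nra.
  split; first exact: cube_convex.
  by exists i; rewrite !mxE eE eqxx subrr mulr0 addr0.
apply: (sign_segment (a := 0) ch h1) => // q q01; split => /=.
  by rewrite in_itv /= add0r subr0 scaler0 lexx ler01.
rewrite add0r subr0; split; first exact: cube_scale.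
pose a : 'I_k.+2 := if i == 0 then 1 else 0.
exists a; left; rewrite mxE eE /a; case: (eqVneq i 0) => [->|i0] /=.
  by rewrite mulr0.
by rewrite eq_sym (negbTE i0) mulr0.
Qed.

(** The lift starts at [s] over the origin. Over the boundary it represents the constant tensor
    [A0], so its components are those of [s] up to signs, and these are constant by
    [boundary_sign]. *)
Lemma lift_homotopy k (H : R * 'rV[R]_k.+2 -> X) :
  {within cylinder k.+2, continuous H} ->
  (forall r t, 0 <= r <= 1 -> cube_boundary t -> H (r, t) = A0) ->
  exists w : forall j, R * 'rV[R]_k.+2 -> sphere R (m j),
    [/\ forall j, {within cylinder k.+2, continuous (w j)},
        forall z, cylinder k.+2 z -> represents (val (H z)) (fun j => val (w j z)) &
        forall j r t, 0 <= r <= 1 -> cube_boundary t -> w j (r, t) = s j].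
Proof.
move=> cH Hb.
have b0 : cube_boundary (0 : 'rV[R]_k.+2).
  by split; [exact: cube0|exists 0; left; rewrite mxE].
have r01 : 0 <= (0 : R) <= 1 by rewrite lexx ler01.
have bc z : (`[0, 1] `*` @cube_boundary R k.+2) z -> cylinder k.+2 z.
  by move=> [z1 [z2 _]].
have A0s : represents (val A0) (fun j => val (s j)).
  by rewrite A0E; exact: represents_sphere.
have [||||||w [cw wP w0]] := lift_rank_one sigmaM innerP inner_sigma (K := cylinder k.+2)
    (f := fun z => val (H z)) (u0 := fun j => val (s j)) (@compact_cylinder R k.+2).
- by apply: in_cylinder => //; exact: cube0.
- exact: cylinder_norm.
- by move=> r z; exact: cylinder_scale.
- exact/subtype_continuous.
- by move=> z _; apply/XP; exact: set_mem (valP (H z)).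
- by have -> : H 0 = A0 by exact: Hb.
pose w' j z := to_subtype (s j) (w z j).
have w'E j z : cylinder k.+2 z -> val (w' j z) = w z j.
  by move=> /wP[w1 _]; rewrite to_subtypeK //; exact: dot_sphere.
exists w'; split.
- move=> j; apply: to_subtype_continuous (cw j) => z /wP[w1 _]; exact: dot_sphere.
- move=> z cz; have -> : (fun j => val (w' j z)) = w z; last exact: wP.
  by apply: functional_extensionality_dep => j; rewrite w'E.
move=> j r t rP bt; apply: val_inj.
have cz : cylinder k.+2 (r, t) by apply: in_cylinder => //; exact: bt.1.
rewrite w'E //; apply/esym/unit_eq; rewrite ?sphere_dot ?(proj1 (wP _ cz)) //.
apply: (@boundary_sign k (fun z => dot (val (s j)) (w z j))) => //.
- apply: dot_continuous; first exact: cst_continuous.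
  exact: (continuous_subspaceW bc (cw j)).
- move=> [r' t'] z'; apply: (represents_sign innerP inner_sigma A0s).
  by have := wP _ (bc _ z'); rewrite Hb //; have [/=] := z'; rewrite in_itv.
- by rewrite w0 sphere_dot.
Qed.

Lemma slice_continuous k (Y : topologicalType) (H : R * 'rV[R]_k -> Y) (r : R) :
  0 <= r <= 1 -> {within cylinder k, continuous H} ->
  {within @cube R k, continuous (fun t => H (r, t))}.
Proof.
move=> r01 cH; refine (within_comp _ _ cH).
  apply/continuous_subspaceT/pair_continuous; first exact: cst_continuous.
  by move=> ?.
by move=> t; exact: in_cylinder.
Qed.

(** The end slices of the lifted homotopy lift the same maps as [f] and [g] and agree with them at
    the corner 0; by uniqueness they are [f] and [g]. *)
Lemma tensor_spheroid_inj k (f g : forall j, @spheroid R k.+2 _ (s j)) :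
  homotopic (tensor_spheroid f) (tensor_spheroid g) ->
  forall j, homotopic (f j) (g j).
Proof.
move=> [H [cH H0 H1 Hb]] j; have [w [cw wP wb]] := lift_homotopy cH Hb.
have b0 : cube_boundary (0 : 'rV[R]_k.+2).
  by split; [exact: cube0|exists 0; left; rewrite mxE].
have slice (r : R) (h : forall j, @spheroid R k.+2 _ (s j)) : 0 <= r <= 1 ->
    (forall t, cube t -> H (r, t) = tensor_spheroid h t) ->
    forall t, cube t -> w j (r, t) = h j t.
  move=> r01 Hh t ct; apply: val_inj.
  apply: (@lift_unique k.+2 (fun t => val (tensor_spheroid h t))
    (fun t j => val (w j (r, t))) (fun t j => val (h j t))) => //.
  - move=> i; apply/subtype_continuous; exact: slice_continuous r01 (cw i).
  - move=> i; apply/subtype_continuous; exact: spheroid_continuous.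
  - move=> t' ct'; rewrite -Hh //; apply: wP; exact: in_cylinder.
  - by move=> t' ct'; rewrite val_tensor_map; exact: represents_sphere.
  - by apply: functional_extensionality_dep => i; rewrite wb // spheroid_boundary.
exists (w j); split.
- exact: cw.
- by move=> t ct; apply: (slice 0 f) => //; rewrite lexx ler01.
- by move=> t ct; apply: (slice 1 g) => //; rewrite lexx ler01.
- by move=> r t r01 bt; exact: wb.
Qed.

Lemma tensor_spheroid_surj k (f : @spheroid R k.+2 _ A0) :
  exists g : forall j, @spheroid R k.+2 _ (s j), homotopic (tensor_spheroid g) f.
Proof.
have [||w [cw wP wb]] := @lift_homotopy k (fun z => f z.2).
- refine (within_comp _ _ (@spheroid_continuous _ _ _ _ f)); last by move=> z [].
  exact/continuous_subspaceT/snd_continuous.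
- by move=> r t _; exact: spheroid_boundary.
have r01 : 0 <= (0 : R) <= 1 by rewrite lexx ler01.
pose g j : @spheroid R k.+2 _ (s j) :=
  Spheroid (slice_continuous r01 (cw j)) (fun t => wb j 0 t r01).
exists g.
(* The tensor of the lifted components equals [f] up to a positive factor, so the straight-line
   homotopy only rescales and never leaves the rank-one tensors. *)
pose G (z : R * 'rV[R]_k.+2) : euclidean T :=
  (1 - z.1) *: (val (tensor_spheroid g z.2) : T) + z.1 *: (val (f z.2) : T).
have GX z : cylinder k.+2 z -> X (G z).
  case: z => r t [/=]; rewrite in_itv /= => r1 ct.
  have [|w1 [c c0 fE]] := wP (0, t); first exact: in_cylinder.
  rewrite /G /= val_tensor_map fE scalerA -scalerDl; apply: X_scale.
    by nra.
  by move=> j; exact/unit_neq0.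
apply: (homotopic_subtype (G := G)) => //.
- apply: euclidean_lincomb_continuous.
  + have : continuous (fun z : R * 'rV[R]_k.+2 => 1 - z.1) by solve_continuous.
    exact: continuous_subspaceT.
  + exact/continuous_subspaceT/fst_continuous.
  + apply/subtype_continuous.
    refine (within_comp _ _ (@spheroid_continuous _ _ _ _ (tensor_spheroid g))).
      exact/continuous_subspaceT/snd_continuous.
    by move=> z [].
  + apply/subtype_continuous.
    refine (within_comp _ _ (@spheroid_continuous _ _ _ _ f)).
      exact/continuous_subspaceT/snd_continuous.
    by move=> z [].
- by move=> t ct; rewrite /G /= subr0 scale1r scale0r addr0.
- by move=> t ct; rewrite /G /= subrr scale1r scale0r add0r.
- by move=> r t r1 bt; rewrite /G !spheroid_boundary // -scalerDl subrK scale1r.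
Qed.

Lemma rank_one_homotopy_group k : (2 <= k)%N ->
  group_isomorphic (homotopy_group R k A0)
    (direct_product (fun j => homotopy_group R k (s j))).
Proof.
case: k => [|[|k]] // _.
pose F (a : direct_product (fun j => homotopy_group R k.+2 (s j))) :
    homotopy_group R k.+2 A0 :=
  homotopy_class (k := k.+2) (tensor_spheroid (fun j => repr (a j))).
apply: (@group_isomorphic_inv _ _ F).
- move=> a b; rewrite /F [RHS]homotopy_mulE; apply/homotopy_classP.
  apply: homotopic_trans (tensor_concat _ _).
  by apply: tensor_spheroid_homotopic => j; exact: homotopic_repr.
- move=> a b /homotopy_classP/tensor_spheroid_inj ab.
  apply: functional_extensionality_dep => j.
  rewrite -[a j]reprK -[b j]reprK; apply/homotopy_classP; exact: ab.
- apply: (@homotopy_group_ind R k.+2 _ A0) => f; have [g gf] := tensor_spheroid_surj f.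
  exists (fun j => homotopy_class (k := k.+2) (g j)); apply/homotopy_classP.
  apply: homotopic_trans gf; apply: tensor_spheroid_homotopic => j.
  exact: (@homotopic_repr R k.+2 _ (s j) (g j)).
Qed.

End rank_one_homotopy.

(** * Homotopy groups of spheres in low degree *)

Section lipschitz_maps.
Context {R : realType} {k : nat}.
Implicit Types (x y t : 'rV[R]_k).

(* Pigeonhole: a grid of [M ^ m] points in the target cube cannot be hit from
   [O(M ^ k)] cells of the source, whose images are smaller than the mesh. *)
Lemma lipschitz_not_onto m (q : 'rV[R]_k -> 'I_m -> R) (L : nat) : (k < m)%N ->
  (forall x y i, cube x -> cube y -> `|q x i - q y i| <= L%:R * `|x - y|) ->
  exists b : 'I_m -> R, (forall i, 0 <= b i <= 1) /\
    forall t, cube t -> exists i, q t i != b i.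
Proof.
move=> km qL; apply: contrapT => noB.
(* [c > L] makes the image of a cell of side 1/N vary by at most L/(cM) < 1/M. [M > (c+1)^k] gives
   M^m >= M^(k+1) > ((c+1)M)^k >= (N+1)^k, more grid points than cells. *)
pose c := L.+1; pose M := (c.+1 ^ k).+1; pose N := (c * M)%N.
have M0 : (0 : R) < M%:R by rewrite ltr0n.
have N0 : (0 : R) < N%:R by rewrite ltr0n muln_gt0.
pose b (a : {ffun 'I_m -> 'I_M}) (i : 'I_m) : R := (a i)%:R / M%:R.
have hit a : exists t, cube t /\ forall i, q t i = b a i.
  apply: contrapT => noT; apply: noB; exists (b a); split=> [i|t ct].
    by rewrite divr_ge0 //= ler_pdivrMr // mul1r ler_nat ltnW.
  apply: contrapT => noI; apply: noT; exists t; split=> // i.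
  by apply/eqP/negPn/negP => qb; apply: noI; exists i.
have {hit}[t tP] := choice hit.
(* There are [N.+1] cells per axis, not [N]: the coordinate 1 falls into the last one. *)
pose cell a : {ffun 'I_k -> 'I_N.+1} := [ffun i => inord (Num.truncn (t a 0 i * N%:R))].
have cellE a i : (cell a i)%:R <= t a 0 i * N%:R < (cell a i).+1%:R.
  have /andP[t0 t1] := (tP a).1 i.
  have tN0 : 0 <= t a 0 i * N%:R by rewrite mulr_ge0.
  rewrite ffunE inordK ?truncn_itv // ltnS -(ler_nat R).
  apply: (le_trans (y := t a 0 i * N%:R)); last by rewrite ler_piMl.
  by have /andP[] := truncn_itv tN0.
have cell_inj : injective cell.
  move=> a a' aa'; apply/ffunP => i; apply/val_inj/eqP.
  have tt : `|t a - t a'| <= N%:R^-1.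
    apply: rV_norm_le => [|l]; first by rewrite invr_ge0 ltW.
    rewrite !mxE -[leRHS]mul1r ler_pdivlMr //.
    rewrite -[X in _ * X]gtr0_norm // -normrM mulrBl ler_norml.
    have := cellE a l; have := cellE a' l; rewrite aa' -natr1; lra.
  have := qL (t a) (t a') i (tP a).1 (tP a').1; rewrite (tP a).2 (tP a').2.
  move=> /le_trans/(_ (ler_wpM2l (ler0n _ _) tt)).
  rewrite /b -mulrBl normrM normfV [`|M%:R|]gtr0_norm // ler_pdivrMr //.
  have -> : L%:R / N%:R * M%:R = L%:R / c%:R :> R.
    by rewrite /N natrM; field; rewrite gt_eqF //= pnatr_eq0.
  move=> dle; have : `|(a i)%:R - (a' i)%:R| < (1 : R).
    by apply: le_lt_trans dle _; rewrite ltr_pdivrMr ?ltr0n // mul1r ltr_nat.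
  rewrite ltr_norml => /andP[d1 d2]; rewrite eqn_leq.
  by apply/andP; split; rewrite -ltnS -(ltr_nat R) -natr1; lra.
have := leq_card cell cell_inj; rewrite !card_ffun !card_ord leqNgt => /negP; apply.
apply: (@leq_ltn_trans ((c.+1 * M) ^ k)).
  have NM : (N.+1 <= c.+1 * M)%N by rewrite mulSn -add1n leq_add2r.
  by case: (k) => // k'; rewrite leq_exp2r.
rewrite expnMn; apply: (@leq_trans (M ^ k.+1)); last by rewrite leq_pexp2l.
by rewrite expnS ltn_pmul2r ?expn_gt0.
Qed.

Lemma lipschitz_continuous_cube (g : 'rV[R]_k -> R) (L : nat) :
  (forall x y, cube x -> cube y -> `|g x - g y| <= L%:R * `|x - y|) ->
  {within @cube R k, continuous g}.
Proof.
move=> gL; apply/subspace_continuousP => x cx; apply/cvgrPdist_lt => e e0.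
(* [L.+1] replaces [L], which may be 0, as a divisor. *)
have L0 : (0 : R) < L.+1%:R by rewrite ltr0n.
have : \forall t \near x, `|x - t| < e / L.+1%:R.
  have := @nbhsx_ballx R _ x (e / L.+1%:R); rewrite -ball_normE; apply.
  exact: divr_gt0.
rewrite near_withinE; apply: filterS => t xt ct; apply: le_lt_trans (gL x t cx ct) _.
apply: (@le_lt_trans _ _ (L.+1%:R * `|x - t|)).
  by apply: ler_wpM2r => //; rewrite ler_nat.
by rewrite mulrC -ltr_pdivlMr.
Qed.

Lemma lipschitz_approx (f : 'rV[R]_k -> R) (e : R) : 0 < e ->
  {within @cube R k, continuous f} -> (forall t, cube t -> `|f t| <= 1) ->
  exists (L : nat) (g : 'rV[R]_k -> R),
    (forall x y, cube x -> cube y -> `|g x - g y| <= L%:R * `|x - y|) /\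
    forall t, cube t -> `|g t - f t| <= e.
Proof.
move=> e0 cf f1.
have [|z _|N NP] := @compact_near_diagonal R _ (@cube R k)
    (fun z => e - `|f z.1 - f z.2|) (@compact_cube R k).
- apply: fun_addr_continuous; first exact: cst_continuous.
  apply: fun_oppr_continuous => z; apply: cvg_norm.
  have cfst : {within @cube R k `*` @cube R k, continuous (fun z => f z.1)}.
    refine (within_comp _ _ cf); last by move=> z' [].
    exact/continuous_subspaceT/fst_continuous.
  have csnd : {within @cube R k `*` @cube R k, continuous (fun z => f z.2)}.
    refine (within_comp _ _ cf); last by move=> z' [].
    exact/continuous_subspaceT/snd_continuous.
  by apply: cvgB; [exact: cfst|exact: csnd].
- by rewrite /= subrr normr0 subr0.
(* Within distance 1/(N+1) uniform continuity bounds the drop of [f] by [e]; farther away the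
   penalty is at least 2, the largest possible oscillation of [f]. *)
pose L := (2 * N.+1)%N; exists L.
pose S x := [set f y + L%:R * `|x - y| | y in @cube R k].
have lbS x : cube x -> lbound (S x) (f x - e).
  move=> cx _ [y cy <-]; have [xy|xy] := leP `|x - y| N.+1%:R^-1.
    have /= := NP x y cx cy xy; rewrite subr_gt0 ltr_norml.
    have : 0 <= L%:R * `|x - y| by rewrite mulr_ge0.
    by lra.
  have : 2 <= L%:R * `|x - y|.
    rewrite /L natrM -mulrA ler_pMr // -ler_pdivrMl ?ltr0n // mulr1; exact: ltW.
  by have := f1 x cx; have := f1 y cy; rewrite !ler_norml; lra.
have S0 x : S x !=set0 by exists (f 0 + L%:R * `|x - 0|); exists 0 => //; exact: cube0.
have Sinf x y : cube x -> cube y -> inf (S x) <= f y + L%:R * `|x - y|.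
  by move=> cx cy; apply: ge_inf; [exists (f x - e); exact: lbS|exists y].
exists (fun x => inf (S x)); split=> [x y cx cy|x cx]; last first.
  have := Sinf x x cx cx; have := lb_le_inf (S0 x) (lbS x cx).
  by rewrite subrr normr0 mulr0 ler_norml; lra.
have half x' y' : cube x' -> cube y' -> inf (S x') - L%:R * `|x' - y'| <= inf (S y').
  move=> cx' cy'; apply: lb_le_inf => // _ [z cz <-].
  have := Sinf x' z cx' cz.
  have : L%:R * `|x' - z| <= L%:R * (`|x' - y'| + `|y' - z|).
    by apply: ler_wpM2l => //; exact: ler_distD.
  by rewrite mulrDr; lra.
have := half x y cx cy; have := half y x cy cx; rewrite (distrC y) ler_norml; lra.
Qed.

(** Keeping the boundary value makes the approximation, once normalized, a spheroid at the same base
    point. *)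
Lemma lipschitz_approx_boundary (f : 'rV[R]_k -> R) (a e : R) : 0 < e ->
  {within @cube R k, continuous f} -> (forall t, cube t -> `|f t| <= 1) ->
  (forall t, cube_boundary t -> f t = a) ->
  exists (L : nat) (g : 'rV[R]_k -> R),
    [/\ forall x y, cube x -> cube y -> `|g x - g y| <= L%:R * `|x - y|,
        forall t, cube t -> `|g t - f t| <= e &
        forall t, cube_boundary t -> g t = a].
Proof.
move=> e0 cf f1 fa; have e2 : 0 < e / 2 by rewrite divr_gt0.
have [L [g [gL gf]]] := lipschitz_approx e2 cf f1.
(* Soft thresholding of [g - a] at height [e / 2] restores the boundary value. *)
pose clamp (r : R) := Num.max (- (e / 2)) (Num.min r (e / 2)).
exists L, (fun t => g t - clamp (g t - a)).
have clampE r : [\/ r <= - (e / 2) /\ clamp r = - (e / 2),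
    - (e / 2) <= r <= e / 2 /\ clamp r = r | e / 2 <= r /\ clamp r = e / 2].
  rewrite /clamp; case: (leP r (e / 2)) => re; last first.
    by apply: Or33; rewrite ltW // max_r //; lra.
  case: (leP (- (e / 2)) r) => re'; last by apply: Or31; rewrite ltW.
  by apply: Or32; split.
split=> [x y cx cy|t ct|t bt].
- apply: le_trans (gL x y cx cy).
  case: (clampE (g x - a)) => -[? ->]; case: (clampE (g y - a)) => -[? ->];
    rewrite ler_norml; case: (ger0P (g x - g y)) => ?; lra.
- have := gf t ct; rewrite !ler_norml; case: (clampE (g t - a)) => -[? ->]; lra.
- have := gf t bt.1; rewrite fa // ler_norml.
  case: (clampE (g t - a)) => -[? ->]; lra.
Qed.

End lipschitz_maps.

(** * Spheroids of dimension below that of the sphere are nullhomotopic *)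

Section sphere_homotopy.
Context {R : realType} {l m : nat} {s : sphere R m}.
Local Notation k := l.+1.
Hypothesis km : (k < m)%N.
Implicit Types f g : @spheroid R k _ s.

Let s1 : dot (val s) (val s) = 1. Proof. exact: sphere_dot. Qed.

Lemma spheroid_val_continuous f : {within @cube R k, continuous (fun t => val (f t))}.
Proof. by apply/subtype_continuous; exact: spheroid_continuous. Qed.

Lemma cylinder_fst_continuous :
  {within `[0, 1] `*` @cube R k, continuous (fun z : R * 'rV[R]_k => z.1)}.
Proof. exact/continuous_subspaceT/fst_continuous. Qed.

Lemma spheroid_val_snd_continuous f :
  {within `[0, 1] `*` @cube R k, continuous (fun z : R * 'rV[R]_k => val (f z.2))}.
Proof.
refine (within_comp _ _ (@spheroid_val_continuous f)); last by move=> z [].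
exact/continuous_subspaceT/snd_continuous.
Qed.

(* Contract the sphere minus [p] to [s], projecting the segment from [f t] to [s]
   back to the sphere along the rays from [p]. *)
Lemma missing_point_nullhomotopic f (p : 'rV[R]_m.+1) : dot p p = 1 ->
  (forall t, cube t -> val (f t) != p) -> val s != p -> homotopic f (const_spheroid (x0 := s)).
Proof.
move=> p1 fp sp.
(* The second intersection of the unit sphere with the line through [p] and [y]. *)
pose proj (y : 'rV[R]_m.+1) := p + (2 * (1 - dot p y) / dot (y - p) (y - p)) *: (y - p).
have dotB y : dot (y - p) (y - p) = dot y y - 2 * dot p y + 1.
  by rewrite dotDl !dotDr !dotNl !dotNr p1 (dotC y p); ring.
have proj_id y : dot y y = 1 -> y != p -> proj y = y.
  move=> y1 yp; rewrite /proj; have -> : 2 * (1 - dot p y) = dot (y - p) (y - p).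
    by rewrite dotB y1; ring.
  rewrite divff; first by rewrite scale1r addrC subrK.
  by rewrite dot_eq0 subr_eq0.
have proj1 y : y != p -> dot (proj y) (proj y) = 1.
  rewrite -subr_eq0 -dot_eq0 => yp.
  have : dot p (y - p) = dot p y - 1 by rewrite dotDr dotNr p1.
  rewrite /proj; move: (y - p) yp => e e0 pe.
  rewrite dotDl !dotDr !dotZl !dotZr (dotC e p) p1 pe.
  by move: (dot e e) e0 => D D0; field.
pose y (z : R * 'rV[R]_k) := (1 - z.1) *: val (f z.2) + z.1 *: val s.
(* The inner product with [p] is below 1 at both ends of the segment, hence all along it, whereas
   <p, p> = 1. *)
have yp z : (`[0, 1] `*` @cube R k) z -> y z != p.
  case: z => r t [/=]; rewrite in_itv /= => r01 ct; apply/eqP => yE.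
  have := unit_dot_lt1 (sphere_dot (f t)) p1 (fp t ct).
  have := unit_dot_lt1 s1 p1 sp.
  have : dot (y (r, t)) p = 1 by rewrite yE.
  rewrite /y /= dotDl !dotZl.
  by move: (dot _ p) (dot _ p) => a b; case: (leP a b) => ?; nra.
have cy : {within `[0, 1] `*` @cube R k, continuous y}.
  move=> z; apply: cvgD; apply: cvgZ.
  - by apply: cvgB; [exact: cvg_cst|exact: cylinder_fst_continuous].
  - exact: spheroid_val_snd_continuous.
  - exact: cylinder_fst_continuous.
  - exact: cvg_cst.
apply: (homotopic_subtype (G := fun z => proj (y z))).
- rewrite continuous_subspace_in => z /set_mem cz.
  have cyp : {within `[0, 1] `*` @cube R k, continuous (fun z => y z - p)}.
    by move=> z'; apply: cvgB; [exact: cy|exact: cvg_cst].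
  apply: cvgD; first exact: cvg_cst.
  apply: cvgZ; last exact: cyp.
  apply: cvgM.
    apply: cvgM; first exact: cvg_cst.
    apply: cvgB; first exact: cvg_cst.
    exact: (dot_continuous (fun _ => cvg_cst p) cy).
  apply: cvgV; first by rewrite dot_eq0 subr_eq0 yp.
  exact: (dot_continuous cyp cyp).
- by move=> z cz; apply/dot_sphere/proj1/yp.
- move=> t ct; rewrite /y /= subr0 scale1r scale0r addr0 proj_id ?fp //.
  exact: sphere_dot.
- by move=> t ct; rewrite /y /= subrr scale1r scale0r add0r proj_id.
- move=> r t r01 bt; rewrite /y /= spheroid_boundary // -scalerDl subrK scale1r.
  by rewrite proj_id.
Qed.

(** In the affine chart of ratios of the other coordinates to the first, the pigeonhole lemma finds
    a point [b] of the unit cube that is missed; the missed direction is (1, b). *)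
Lemma lipschitz_missing_direction (g : 'rV[R]_k -> 'rV[R]_m.+1) (e B : R) (L : nat) :
  0 < e -> (forall t i, cube t -> `|g t 0 i| <= B) ->
  (forall x y i, cube x -> cube y -> `|g x 0 i - g y 0 i| <= L%:R * `|x - y|) ->
  (forall t, cube t -> exists i, e <= `|g t 0 i|) ->
  exists2 v : 'rV[R]_m.+1, v != 0 &
    forall t (c : R), cube t -> 0 < c -> g t != c *: v.
Proof.
move=> e0 gB gL ge.
have B0 : 0 <= B by apply: le_trans (gB 0 0 cube0).
(* Cutting the denominator off below at [e] makes the ratios Lipschitz on the whole cube, with
   constant L (1/e + B/e^2), which [L'] rounds up. *)
pose D t := Num.max (g t 0 0) e.
have De t : e <= D t by rewrite le_max lexx orbT.
have D0 t : 0 < D t by exact: lt_le_trans (De t).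
have Dinv0 t : 0 <= (D t)^-1 by rewrite invr_ge0 ltW.
have Dinv t : (D t)^-1 <= e^-1 by rewrite lef_pV2 ?posrE.
have DL x y : cube x -> cube y -> `|D x - D y| <= L%:R * `|x - y|.
  move=> cx cy; apply: le_trans (gL x y 0 cx cy); rewrite ler_norml /D.
  by case: (ger0P (g x 0 0 - g y 0 0)) => ?; case: (leP (g x 0 0) e) => ?;
    case: (leP (g y 0 0) e) => ?; lra.
pose L' := (Num.truncn (L%:R * (e^-1 + B / e ^+ 2))).+1.
have [|x y i cx cy|b [b01 bP]] :=
    @lipschitz_not_onto R k m (fun t i => g t 0 (lift 0 i) / D t) L'.
- exact: km.
- set a := g x 0 _; set a' := g y 0 _.
  have -> : a / D x - a' / D y = (a - a') / D x + a' / (D x * D y) * (D y - D x).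
    by field; rewrite !gt_eqF.
  apply: le_trans (ler_normD _ _) _.
  apply: (@le_trans _ _ (L%:R * (e^-1 + B / e ^+ 2) * `|x - y|)); last first.
    by apply: ler_wpM2r => //; apply/ltW/truncnS_gt.
  have -> : L%:R * (e^-1 + B / e ^+ 2) * `|x - y| =
      L%:R * `|x - y| / e + B / e ^+ 2 * (L%:R * `|x - y|) by ring.
  rewrite !normrM !normfV !normrM !(gtr0_norm (D0 _)); apply: lerD.
    by apply: ler_pM => //; exact: gL.
  have DD0 : 0 <= (D x * D y)^-1 by rewrite invfM mulr_ge0.
  apply: ler_pM => //; [exact: mulr_ge0| |by rewrite distrC; exact: DL].
  apply: ler_pM => //; first exact: gB.
  by rewrite invfM expr2 invfM; apply: ler_pM.
pose v : 'rV[R]_m.+1 := \row_i if unlift 0 i is Some j then b j else 1.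
have v0 : v 0 0 = 1 by rewrite mxE unlift_none.
have vS i : v 0 (lift 0 i) = b i by rewrite mxE liftK.
exists v; first by apply/eqP => /rowP/(_ 0); rewrite v0 mxE => /eqP; rewrite oner_eq0.
move=> t c ct c0; apply/eqP => gE.
have g0 : g t 0 0 = c by rewrite gE mxE v0 mulr1.
have gS i : g t 0 (lift 0 i) = c * b i by rewrite gE mxE vS.
(* All entries of [v] lie in [0, 1] and the first is 1, so [c], the first coordinate of [g t], is
   its largest; the cutoff in [D] is thus inactive at [t]. *)
have ec : e <= c.
  have [i] := ge t ct; rewrite gE mxE normrM gtr0_norm // => /le_trans; apply.
  apply: ler_piMr; first exact: ltW.
  rewrite mxE; case: unliftP => [j _|_]; last by rewrite normr1.
  by have /andP[bj0 bj1] := b01 j; rewrite ger0_norm.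
have [i /eqP] := bP t ct; apply.
by rewrite gS /D g0 max_l // mulrAC divff ?mul1r // gt_eqF.
Qed.

Lemma sphere_nullhomotopic f : homotopic f (const_spheroid (x0 := s)).
Proof.
(* An error [e] in each of the [m.+1] coordinates changes the inner product with the unit vector
   [f t] by at most 1/2, so the segment from [f t] to [g t] avoids 0. *)
pose e : R := (2 * m.+1%:R)^-1.
have e0 : 0 < e by rewrite invr_gt0 mulr_gt0 // ltr0n.
have sum_e : \sum_(i < m.+1) e = 2^-1.
  by rewrite sumr_const card_ord -[LHS]mulr_natr /e invfM -mulrA mulVf ?mulr1 //.
have unit_coord (x : 'rV[R]_m.+1) i : dot x x = 1 -> `|x 0 i| <= 1.
  move=> x1; rewrite -(@expr_le1 _ 2) // -normrX ger0_norm ?sqr_ge0 // -x1 expr2.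
  by rewrite /dot (bigD1 i) //= lerDl sumr_ge0 // => j _; rewrite -expr2 sqr_ge0.
have /choice[L /choice[G GP]] i : exists (L : nat) (g : 'rV[R]_k -> R),
    [/\ forall x y, cube x -> cube y -> `|g x - g y| <= L%:R * `|x - y|,
        forall t, cube t -> `|g t - val (f t) 0 i| <= e &
        forall t, cube_boundary t -> g t = val s 0 i].
  apply: lipschitz_approx_boundary => //.
  - exact: (@comp_continuous _ _ _ _ (fun M : 'rV[R]_m.+1 => M 0 i)
      (@spheroid_val_continuous f) (@coord_continuous _ _ _ _ _)).
  - by move=> t _; apply: unit_coord; exact: sphere_dot.
  - by move=> t bt; rewrite spheroid_boundary.
pose g t : 'rV[R]_m.+1 := \row_i G i t.
have gf t i : cube t -> `|g t 0 i - val (f t) 0 i| <= e.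
  by move=> ct; rewrite mxE; have [_ -> //] := GP i.
have gs t : cube_boundary t -> g t = val s.
  by move=> bt; apply/rowP => i; rewrite mxE; have [_ _ ->] := GP i.
have gL x y i : cube x -> cube y -> `|g x 0 i - g y 0 i| <= (\max_i L i)%:R * `|x - y|.
  move=> cx cy; rewrite !mxE; have [gL _ _] := GP i.
  apply: le_trans (gL x y cx cy) _; apply: ler_wpM2r => //.
  by rewrite ler_nat leq_bigmax.
have half r t : 0 <= r <= 1 -> cube t ->
    2^-1 <= dot (val (f t) + r *: (g t - val (f t))) (val (f t)).
  move=> r01 ct; rewrite dotDl sphere_dot dotZl.
  have : `|dot (g t - val (f t)) (val (f t))| <= 2^-1.
    apply: le_trans (ler_norm_sum _ _ _) _.
    rewrite -sum_e.
    apply: ler_sum => i _; rewrite !mxE normrM -[leRHS]mulr1.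
    have := gf t i ct; rewrite mxE => gfi.
    by apply: ler_pM => //; exact/unit_coord/sphere_dot.
  by rewrite ler_norml; nra.
have h0 r t : 0 <= r <= 1 -> cube t -> val (f t) + r *: (g t - val (f t)) != 0.
  move=> r01 ct; apply/eqP => h0; have := half r t r01 ct.
  by rewrite h0 dot0l leNgt invr_gt0 ltr0n.
have g0 t : cube t -> g t != 0.
  move=> ct; have := h0 1 t; rewrite scale1r addrC subrK; apply => //.
  by rewrite ler01 lexx.
(* If every coordinate were below [e], then <g, f> would be below 1/2. *)
have ge t : cube t -> exists i, e <= `|g t 0 i|.
  move=> ct; apply: contrapT => small.
  have := half 1 t; rewrite scale1r addrC subrK ler01 lexx => /(_ isT ct).
  apply/negP; rewrite -ltNge.
  apply: le_lt_trans (ler_norm _) _; apply: le_lt_trans (ler_norm_sum _ _ _) _.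
  rewrite -sum_e.
  apply: ltr_sum; first by apply/hasP; exists 0; rewrite ?mem_index_enum.
  move=> i _; rewrite normrM -[ltRHS]mulr1.
  apply: (@le_lt_trans _ _ (`|g t 0 i| * 1)).
    by apply: ler_wpM2l => //; exact/unit_coord/sphere_dot.
  by rewrite ltr_pM2r // ltNge; apply/negP => ?; apply: small; exists i.
have cg : {within @cube R k, continuous g}.
  apply: row_continuous => i.
  have -> : (fun t => g t 0 i) = G i by apply/funext => t; rewrite mxE.
  by have [Gi _ _] := GP i; exact: lipschitz_continuous_cube Gi.
have [v v0 vP] : exists2 v : 'rV[R]_m.+1, v != 0 &
    forall t (c : R), cube t -> 0 < c -> g t != c *: v.
  apply: (@lipschitz_missing_direction g e (1 + e) (\max_i L i)) => // t i ct.
  have := gf t i ct; have := unit_coord _ i (sphere_dot (f t)).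
  by rewrite !ler_norml; lra.
pose F t := to_subtype s (normalize (g t)).
have FE t : cube t -> val (F t) = normalize (g t).
  by move=> ct; rewrite to_subtypeK //; apply/dot_sphere/normalize_dot/g0.
have cF : {within @cube R k, continuous F}.
  apply: to_subtype_continuous => [t ct|]; first exact/dot_sphere/normalize_dot/g0.
  exact: normalize_continuous.
have normalize_s : normalize (val s) = val s.
  by rewrite -[X in normalize X]scale1r normalize_unit.
have Fb t : cube_boundary t -> F t = s.
  by move=> bt; apply: val_inj; rewrite FE ?gs //; exact: bt.1.
apply: (@homotopic_trans _ _ _ _ (Spheroid cF Fb)).
  apply: (homotopic_subtype (G := fun z : R * 'rV[R]_k =>
    normalize (val (f z.2) + z.1 *: (g z.2 - val (f z.2))))).
  - apply: normalize_continuous; last first.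
      by move=> [r t] [/=]; rewrite in_itv /=; exact: h0.
    move=> z; apply: cvgD; first exact: spheroid_val_snd_continuous.
    apply: cvgZ.
      exact: cylinder_fst_continuous.
    apply: cvgB; last exact: spheroid_val_snd_continuous.
    have : {within `[0, 1] `*` @cube R k, continuous (fun z : R * 'rV[R]_k => g z.2)}.
      refine (within_comp _ _ cg); last by move=> z' [].
      exact/continuous_subspaceT/snd_continuous.
    by move=> /(_ z).
  - move=> [r t] [/=]; rewrite in_itv /= => r01 ct.
    exact/dot_sphere/normalize_dot/h0.
  - move=> t ct /=; rewrite scale0r addr0 -[val (f t) in LHS]scale1r.
    by rewrite normalize_unit //; exact: sphere_dot.
  - by move=> t ct /=; rewrite scale1r addrC subrK FE.
  - move=> r t r01 bt /=; rewrite spheroid_boundary // gs //.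
    by rewrite subrr scaler0 addr0.
have Fv t : cube t -> val (F t) != normalize v.
  move=> ct; rewrite FE //; apply/eqP => gv.
  pose c := Num.sqrt (dot (g t) (g t)) / Num.sqrt (dot v v).
  have c0 : 0 < c by rewrite divr_gt0 // sqrtr_gt0 dot_gt0 ?g0.
  have /negP := vP t c ct c0; apply; apply/eqP.
  rewrite /c -scalerA -/(normalize v) -gv /normalize scalerA divff ?scale1r //.
  by rewrite gt_eqF // sqrtr_gt0 dot_gt0 g0.
apply: (@missing_point_nullhomotopic _ (normalize v)) => //; first exact: normalize_dot.
(* The base point is a value of [F], so it is not the missed point either. *)
have <- : F 0 = s; last exact/Fv/cube0.
by apply: Fb; split; [exact: cube0|exists 0; left; rewrite mxE].
Qed.

End sphere_homotopy.

(** * Matching of base points and the theorem *)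

Lemma linear_iso_mapping (R : realType) (W : vectType R) (q : nat) (x : 'rV[R]_q) (w : W) :
  \dim {:W} = q -> x != 0 -> w != 0 ->
  exists phi : {linear 'rV[R]_q -> W} * {linear W -> 'rV[R]_q},
    [/\ cancel phi.1 phi.2, cancel phi.2 phi.1 & phi.1 x = w].
Proof.
rewrite dimvf => Wq; subst q => x0 w0.
have w0' : v2r w != 0 by apply: contra_neq w0 => w0; rewrite -[w]v2rK w0 linear0.
(* A rank-one matrix sending [x] to the coordinates of [w]; it is then replaced by an invertible
   matrix with the same value at [x]. *)
pose f := (dot x x)^-1 *: (x^T *m v2r w).
have xf : x *m f = v2r w.
  rewrite /f -scalemxAr mulmxA [x *m x^T]mx11_scalar mul_scalar_mx scalerA.
  have -> : (x *m x^T) 0 0 = dot x x by rewrite mxE; apply: eq_bigr => i _; rewrite mxE.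
  by rewrite mulVf ?dot_eq0 // scale1r.
have [|g gu xg] := @complete_unitmx _ _ _ x f; first by rewrite xf !rank_rV x0 w0'.
exists (r2v \o mulmxr g : {linear _ -> _}, mulmxr (invmx g) \o v2r : {linear _ -> _}).
split=> [y|y|] /=; first by rewrite r2vK mulmxK.
  by rewrite mulmxKV // v2rK.
by rewrite -xg xf v2rK.
Qed.

Lemma sphere_nonempty (R : realType) m : sphere R m (delta_mx 0 0).
Proof. by apply: dot_sphere; rewrite dot_delta mxE !eqxx. Qed.

Unset Implicit Arguments.

(** The vanishing range is the strict [k < (n j1).-1]: for k = n_1 - 1 >= 2 the factor pi_k of the
    sphere of dimension n_1 - 1 is infinite cyclic. *)
Theorem theorem6p5 (R : realType) (d : nat) (hd : (3 <= d)%N)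
    (V : 'I_d -> vectType R) (n : 'I_d -> nat)
    (hdim : forall j : 'I_d, \dim {:V j} = n j)
    (hmono : forall i j : 'I_d, (i <= j)%N -> (n i <= n j)%N)
    (j1 : 'I_d) (hj1 : j1 = 0%N :> nat) (hn1 : (2 <= n j1)%N)
    (T : vectType R) (tau : (forall j : 'I_d, V j) -> T)
    (htau : is_tensor_product tau) :
  (forall k : nat, (2 <= k)%N ->
     forall (A0 : rank_one tau) (s : forall j : 'I_d, sphere R (n j).-1),
       group_isomorphic (homotopy_group R k A0)
         (direct_product (fun j : 'I_d => homotopy_group R k (s j)))) /\
  (forall k : nat, (2 <= k < (n j1).-1)%N ->
     forall (A0 : rank_one tau) (a : homotopy_group R k A0), a = 1%g).
Proof.
have nj j : (n j1 <= n j)%N by apply: hmono; rewrite hj1.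
have nE j : (n j).-1.+1 = n j by rewrite prednK //; have := leq_trans hn1 (nj j); case: (n j).
have iso k : (2 <= k)%N -> forall (A0 : rank_one tau) (s : forall j, sphere R (n j).-1),
    group_isomorphic (homotopy_group R k A0)
      (direct_product (fun j => homotopy_group R k (s j))).
  move=> k2 A0 s; have /set_mem[v0 [v0_neq0 A0E]] := valP A0.
  (* The isomorphisms send [s j] to the components [v0 j] of [A0], so that tensoring maps the base
     point [s] exactly to [A0]. *)
  have iso j := linear_iso_mapping (etrans (hdim j) (esym (nE j)))
    (unit_neq0 (sphere_dot (s j))) (v0_neq0 j).
  pose phi j := (sval (cid (iso j))).1; pose psi j := (sval (cid (iso j))).2.
  have phiK j : cancel (phi j) (psi j) by case: (svalP (cid (iso j))).
  have psiK j : cancel (psi j) (phi j) by case: (svalP (cid (iso j))).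
  have phi_s j : phi j (val (s j)) = v0 j by case: (svalP (cid (iso j))).
  have [inner [innerP inner_sigma]] := tensor_inner htau phiK.
  apply: (rank_one_homotopy_group (multilinear_subst htau.1 phi) innerP inner_sigma j1) => //.
  - move=> A; split=> [[v [v_neq0 ->]]|[w [w_neq0 ->]]].
      exists (fun j => psi j (v j)); split=> [j|].
        by apply: contra_neq (v_neq0 j) => psi0; rewrite -[v j]psiK psi0 linear0.
      by congr tau; apply: functional_extensionality_dep => j; rewrite psiK.
    exists (fun j => phi j (w j)); split=> // j.
    by apply: contra_neq (w_neq0 j) => phi0; rewrite -[w j]phiK phi0 linear0.
  - by rewrite A0E; congr tau; apply: functional_extensionality_dep => j; rewrite phi_s.
split=> // k /andP[k2 kn] A0 a.
pose s j : sphere R (n j).-1 := SigSub (mem_set (@sphere_nonempty R (n j).-1)).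
have [F /bij_inj Finj] := iso k k2 A0 s.
(* As [F] is injective, triviality of every factor suffices. *)
suff trivial j (b : homotopy_group R k (s j)) : b = 1%g.
  apply: Finj; apply: functional_extensionality_dep => j.
  by rewrite (trivial j (F a j)) (trivial j (F 1%g j)).
apply: (@homotopy_group_ind R k _ (s j) (fun b => b = 1%g)) => f.
apply/homotopy_classP/sphere_nullhomotopic.
have kn' : (k < (n j).-1)%N by rewrite (leq_trans kn) // -!subn1 leq_sub2r.
by case: (k) k2 kn'.
Qed.
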